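(* Let $d_i, d_u > 1$ and $c_i, c_u > 0$. Let $G=(V,\mathcal{E})$ be an infinite connected locally finite graph satisfying the local isoperimetric inequality $\mathcal{L}(d_i,c_i)$ and the volume upper bound $\mathcal{V}_u(d_u,c_u)$, and consider Bernoulli site percolation on $G$ with parameter $p$. Then $p_c(G) < 1$. More precisely, let $d_l, c_l$ be constants such that $G$ satisfies the volume lower bound $\mathcal{V}_l(d_l,c_l)$ (one may always take $d_l=c_l=1$). There is $p_* = p_*(d_i,c_i,d_u,c_u,d_l,c_l) < 1$, depending on $G$ only through these constants, such that for every $p \in (p_*,1]$ there exists almost surely a unique infinite open connected component. Moreover, for every $\chi>0$ and every $p$ large enough (that is, there is $p_\chi<1$ such that for all $p \in (p_\chi,1]$), $$\lim_{n\to\infty} n^{\chi}\, \sup_{x\in V} \mathbb{P}\big[\, n < |\mathcal{C}_x| < \infty \,\big] = 0 .$$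
   Context: $d(\cdot,\cdot)$ is the graph distance, and $B(x,r)=\{y\in V: d(x,y)\le r\}$. For $A\subseteq B\subseteq V$, $\partial_B A=\{\{x,y\}\in\mathcal{E}: x\in A,\ y\in B\setminus A\}$ is the edge boundary of $A$ relative to $B$. $\mathcal{L}(d_i,c_i)$ (local isoperimetric inequality): for every $x\in V$, $r\ge 1$ and every $A\subseteq B:=B(x,r)$ with $|A|\le |B(x,r)|/2$, one has $|\partial_B A|\ge c_i|A|^{(d_i-1)/d_i}$. $\mathcal{V}_u(d_u,c_u)$ (volume upper bound): $|B(x,r)|\le c_u r^{d_u}$ for all $x\in V$, $r\ge1$. $\mathcal{V}_l(d_l,c_l)$ (volume lower bound): $|B(x,r)|\ge c_l r^{d_l}$ for all $x\in V$, $r\ge1$. Bernoulli site percolation with parameter $p\in[0,1]$: $\mathbb{P}$ is the product measure on $\{0,1\}^V$ under which each vertex is independently open (value $1$) with probability $p$ and closed (value $0$) otherwise. $\mathcal{C}_x$ is the connected component of open vertices containing $x$ (empty if $x$ is closed). $p_c(G)=\sup\{p\in[0,1]: \mathbb{P}[\text{there exists an infinite open cluster}]=0\}$. *)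

(* Defs.v *)
From HB Require Import structures.
From mathcomp Require Import all_boot all_order all_algebra finmap ring lra.
From mathcomp Require Import all_classical all_reals all_analysis.
From mathcomp Require Import measurable_realfun.

Set Implicit Arguments.
Unset Strict Implicit.
Unset Printing Implicit Defensive.

Import Order.TTheory GRing.Theory Num.Theory.
Import numFieldNormedType.Exports.

Local Open Scope classical_set_scope.
Local Open Scope ring_scope.

Section Graph.
Context {V : choiceType}.
Implicit Types (e : rel V) (x y : V) (r : nat) (A B : set V).

Definition simple_graph e := symmetric e /\ irreflexive e.

Definition is_walk e x y n :=
  exists s : seq V, [/\ path e x s, last x s = y & size s = n].

Definition connected_graph e := forall x y, exists n, is_walk e x y n.

Definition locally_finite e := forall x, finite_set [set y | e x y].

(* The value is the junk 0 if no walk joins x to y. *)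
Definition gdist e x y : nat :=
  xget 0%N [set n | is_walk e x y n /\ forall m, is_walk e x y m -> (n <= m)%N].

Definition gball e x r : set V := [set y | (gdist e x y <= r)%N].

Definition edge_boundary e B A : set {fset V} :=
  [set E | exists x y, [/\ A x, (B `\` A) y, e x y & E = [fset x; y]%fset]].

End Graph.

(* Meaningful for finite sets only: fset_set sends infinite sets to fset0. *)
Definition set_card {T : choiceType} (A : set T) : nat := #|` fset_set A |.

Section Volume.
Context {R : realType} {V : choiceType}.
Implicit Types (e : rel V).

Definition local_isoperimetry (di ci : R) e :=
  forall (x : V) (r : nat) (A : set V), (1 <= r)%N ->
    A `<=` gball e x r -> (set_card A)%:R <= (set_card (gball e x r))%:R / 2 :> R ->
    ci * (set_card A)%:R `^ ((di - 1) / di)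
      <= (set_card (edge_boundary e (gball e x r) A))%:R.

Definition volume_upper (du cu : R) e :=
  forall (x : V) (r : nat), (1 <= r)%N ->
    (set_card (gball e x r))%:R <= cu * r%:R `^ du.

Definition volume_lower (dl cl : R) e :=
  forall (x : V) (r : nat), (1 <= r)%N ->
    cl * r%:R `^ dl <= (set_card (gball e x r))%:R.

End Volume.

Definition cylinders (V : choiceType) : set (set (V -> bool)) :=
  [set C | exists x : V, exists b : bool, C = [set w | w x = b]].

Definition config (V : choiceType) := g_sigma_algebraType (@cylinders V).

Definition is_product_bernoulli {R : realType} {V : choiceType} (p : R)
    (P : probability (config V) R) :=
  forall (A : {fset V}) (b : V -> bool),
    P [set w | forall x, x \in A -> w x = b x] =
    (\prod_(x <- A) (if b x then p else 1 - p))%:E.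

(* Existence of the product measure for countable V and 0 <= p <= 1: push the
   uniform measure on [0, 1[ forward by an expansion whose successive digits
   split each interval in proportions p and 1 - p. *)
Section Exists.
Context {R : realType} (p : R) (hp : 0 <= p <= 1).

Let shift (u : R) : R := if u < p then u / p else (u - p) / (1 - p).
Let digit (n : nat) (u : R) : bool := iter n shift u < p.
Let weight (b : bool) : R := if b then p else 1 - p.
Let weights (s : seq bool) : R := \prod_(b <- s) weight b.
Let owt (c : option bool) : R := if c is Some b then weight b else 1.

Let weights_ge0 s : 0 <= weights s.
Proof.
case/andP: hp => p0 p1.
by apply: prodr_ge0 => -[] _; rewrite /weight ?subr_ge0.
Qed.

Fixpoint bits_code (s : seq bool) (u : R) : bool :=
  if s is b :: s' then ((u < p) == b) && bits_code s' (shift u) else true.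

Let bits_code_itv s : exists a : R, [/\ 0 <= a, a + weights s <= 1 &
  forall u, (0 <= u < 1) && bits_code s u = (a <= u < a + weights s)].
Proof.
elim: s => [|b s [a [a0 a1 ih]]].
  exists 0; rewrite /weights big_nil; split => [//||u]; first by rewrite add0r.
  by rewrite /= andbT add0r.
have w0 := weights_ge0 s.
case/andP: hp => hp0 hp1.
rewrite /weights big_cons -/(weights s).
case: b => /=.
- exists (p * a); split; [nra|nra|] => u /=.
  case: (ltP u p) => up /=; last first.
    by rewrite andbF; apply/esym/negbTE; rewrite negb_and -ltNge -leNgt; apply/orP; right; nra.
  rewrite /shift up.
  case: (leP 0 u) => u0 /=; last first.
    by apply/esym/negbTE; rewrite negb_and -ltNge; apply/orP; left; nra.
  have p0 : 0 < p by apply: le_lt_trans up.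
  have -> : u < 1 by lra.
  have h := ih (u / p).
  have -> : bits_code s (u / p) = (0 <= u / p < 1) && bits_code s (u / p).
    by rewrite divr_ge0 ?(ltW p0)// ltr_pdivrMr// mul1r up.
  rewrite h ler_pdivlMr// ltr_pdivrMr// (mulrC a) -mulrDr.
  by rewrite (mulrC (a + _)).
- exists (p + (1 - p) * a); split; [nra|nra|] => u /=.
  rewrite eqbF_neg -leNgt.
  case: (leP p u) => up /=; last first.
    by rewrite andbF; apply/esym/negbTE; rewrite negb_and -ltNge; apply/orP; left; nra.
  have -> : shift u = (u - p) / (1 - p) by rewrite /shift ltNge up.
  case: (ltP u 1) => u1; last first.
    by rewrite andbF; apply/esym/negbTE; rewrite negb_and -leNgt; apply/orP; right; nra.
  have p1 : 0 < 1 - p by lra.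
  have -> : 0 <= u by lra.
  have h := ih ((u - p) / (1 - p)).
  rewrite /=.
  have -> : bits_code s ((u - p) / (1 - p)) =
    (0 <= (u - p) / (1 - p) < 1) && bits_code s ((u - p) / (1 - p)).
    rewrite divr_ge0 ?(ltW p1) ?subr_ge0// ltr_pdivrMr// mul1r.
    by have -> : u - p < 1 - p by lra.
  rewrite h ler_pdivlMr// ltr_pdivrMr//.
  congr (_ && _); first by apply/idP/idP; nra.
  by apply/idP/idP; nra.
Qed.

Let measurable_shift : measurable_fun [set: R] shift.
Proof.
apply: measurable_fun_ifT.
- exact: measurable_fun_ltr.
- exact: measurable_funM.
- by apply: measurable_funM => //; exact: measurable_funB.
Qed.

Let measurable_iter n : measurable_fun [set: R] (iter n shift).
Proof.
elim: n => [|n ih] /=; first exact: measurable_id.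
exact: measurableT_comp.
Qed.

Let measurable_digit n b : measurable [set u | digit n u = b].
Proof.
have : measurable_fun [set: R] (digit n).
  by apply: measurable_fun_ltr.
by move=> /(_ measurableT [set b] Logic.I); rewrite setTI.
Qed.

Let mu := @lebesgue_measure R.

Let pat (s : seq bool) (c : seq (option bool)) : set R :=
  [set u | 0 <= u < 1 /\ forall i b, nth None (map Some s ++ c) i = Some b -> digit i u = b].

Let bits_codeP s u : reflect (forall i b, nth None (map Some s) i = Some b -> digit i u = b) (bits_code s u).
Proof.
elim: s u => [|a s ih] u /=.
  by apply: ReflectT => i b; rewrite nth_nil.
apply: (iffP andP) => [[/eqP ha /ih hs] [|i] b /=|h].
- by move=> [<-].
- by move=> /hs; rewrite /digit -iterSr.
- split; first by rewrite -(h 0%N a).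
  apply/ih => i b hi; have := h i.+1 b hi.
  by rewrite /digit -iterSr.
Qed.

Let measurable_pat s c : measurable (pat s c).
Proof.
have -> : pat s c = `[0, 1[%classic `&`
   \bigcap_i \bigcap_(b in [set b | nth None (map Some s ++ c) i = Some b])
     [set u | digit i u = b].
  apply/seteqP; split => u /=.
    by move=> [u01 h]; split; [rewrite /= in_itv|move=> i _ b /= /h].
  by rewrite in_itv => -[u01 h]; split => // i b /h; exact.
apply: measurableI; first exact: measurable_itv.
apply: bigcap_measurableType => i _.
exact: fin_bigcap_measurable.
Qed.

Let mu_setU (A B : set R) : measurable A -> measurable B -> A `&` B = set0 ->
  mu (A `|` B) = (mu A + mu B)%E.
Proof. by move=> mA mB AB; rewrite /mu measureU. Qed.

Let mu_pat s c : mu (pat s c) = (weights s * \prod_(x <- c) owt x)%:E.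
Proof.
elim: c s => [|[b|] c ih] s.
- rewrite big_nil mulr1.
  have [a [a0 a1 h]] := bits_code_itv s.
  have -> : pat s [::] = `[a, (a + weights s)[%classic.
    apply/seteqP; split => u; rewrite /pat /= cats0 in_itv /= -h.
      by move=> [-> /bits_codeP ->].
    by move=> /andP[-> /bits_codeP].
  rewrite /mu lebesgue_measure_itv /= lte_fin ltrDl.
  case: ltP => w0; first by rewrite -EFinD addrAC subrr add0r.
  by have -> : weights s = 0 by apply/eqP; rewrite eq_le w0 weights_ge0.
- rewrite big_cons mulrA /=.
  have -> : weights s * weight b = weights (rcons s b) by rewrite /weights -cats1 big_cat /= big_seq1.
  by rewrite -ih /pat map_rcons cat_rcons.
- rewrite big_cons mul1r.
  have -> : pat s (None :: c) = pat (rcons s true) c `|` pat (rcons s false) c.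
    apply/seteqP; split => u /=.
      move=> [u01 h].
      have aux b0 : digit (size s) u = b0 -> pat (rcons s b0) c u.
        move=> E; split => // i b; move: (h i b).
        rewrite map_rcons cat_rcons !nth_cat size_map.
        case: ltnP => // si; rewrite leq_eqVlt in si; move: si => /orP[/eqP <-|si].
          by rewrite subnn /= => _ [<-].
        by rewrite -(subnSK si).
      by case E : (digit (size s) u); [left|right]; exact: aux.
    have aux b0 : pat (rcons s b0) c u -> pat s (None :: c) u.
      move=> [u01 h]; split=> // i b; move: (h i b).
      rewrite map_rcons cat_rcons !nth_cat size_map.
      case: ltnP => // si; rewrite leq_eqVlt in si; move: si => /orP[/eqP <-|si].
        by rewrite subnn.
      by rewrite -(subnSK si).
    by case; exact: aux.
  rewrite mu_setU//.
    rewrite !ih -EFinD -mulrDl; congr (_ * _)%:E.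
    rewrite /weights -!cats1 !big_cat /= !big_seq1 /weight; ring.
  apply/seteqP; split => // u [] /= [_ h1] [_ h2].
  have := h1 (size s) true; have := h2 (size s) false.
  rewrite !map_rcons !cat_rcons !nth_cat size_map ltnn subnn /= => -> // /(_ erefl).
  by [].
Qed.

Lemma exists_product_bernoulli (V : choiceType) :
  countable [set: V] -> exists P : probability (config V) R, is_product_bernoulli p P.
Proof.
move=> /countable_injP[f /in2TT finj].
pose X (u : R) : config V := fun x => digit (f x) u.
have mX : measurable_fun [set: R] X.
  apply (@measurability _ _ _ _ setT X (@cylinders V)); first by [].
  move=> _ [_ [x [b ->]] <-]; rewrite setTI; exact: (measurable_digit (f x) b).
pose T := measurableTypeR R.
have mX' : measurable_fun [set: T] (X : T -> config V).
  by move=> _ Y mY; exact: (mX measurableT Y mY).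
have m01 : measurable (`[0%R, 1%R[%classic : set T) by exact: measurable_itv.
pose Q : {measure set T -> \bar R} := mrestr lebesgue_measure m01.
have Q1 : Q setT = 1%E.
  rewrite /Q /= /mrestr setTI lebesgue_measure_itv /= lte_fin ltr01.
  by rewrite oppr0 adde0.
pose Qm := Measure_isProbability.Build _ _ _ Q Q1.
pose Q' : probability T R := HB.pack (mrestr (lebesgue_measure : {measure set T -> \bar R}) m01) (Measure.class Q) Qm.
pose Xm := isMeasurableFun.Build _ _ _ _ (X : T -> config V) mX'.
pose X' : {mfun T >-> config V} := HB.pack (X : T -> config V) Xm.
pose P : probability (config V) R := distribution Q' X'.
have PE (A : set (config V)) : P A = mu (X @^-1` A `&` `[0%R, 1%R[%classic) by [].
exists P => A b.
rewrite [LHS]PE.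
pose g (i : nat) := ohead [seq x <- enum_fset A | f x == i].
have [N fN] : exists N, forall x, x \in A -> (f x < N)%N.
  by exists (\max_(x <- A) f x).+1 => x xA; rewrite ltnS; apply: leq_bigmax_seq.
pose c := [seq omap b (g i) | i <- iota 0 N].
have gE i x : g i = Some x -> x \in A /\ f x = i.
  rewrite /g; case E : [seq x <- enum_fset A | f x == i] => [//|y s] /= [<-].
  have : y \in [seq x <- enum_fset A | f x == i] by rewrite E inE eqxx.
  by rewrite mem_filter => /andP[/eqP].
have gf x : x \in A -> g (f x) = Some x.
  move=> xA; case E : (g (f x)) => [y|].
    by have [yA /finj ->] := gE _ _ E.
  move: E; rewrite /g; case E : [seq _ <- _ | _] => [|//] _.
  have : x \in [seq y <- enum_fset A | f y == f x] by rewrite mem_filter eqxx.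
  by rewrite E.
have -> : X @^-1` [set w | forall x, x \in A -> w x = b x] `&` `[0%R, 1%R[%classic
   = pat [::] c.
  apply/seteqP; split => u /=; rewrite in_itv /=.
    move=> [h u01]; split => // i b0.
    case: (ltnP i N) => iN; last by rewrite nth_default // size_map size_iota.
    rewrite (nth_map 0%N) ?size_iota// nth_iota// add0n.
    by case E : (g i) => [x|] //= [<-]; have [xA <-] := gE _ _ E; exact: h.
  move=> [u01 h]; split => // x xA; apply: h.
  by rewrite (nth_map 0%N) ?size_iota ?fN// nth_iota ?fN// add0n gf.
rewrite mu_pat /weights big_nil mul1r; congr EFin.
rewrite big_map -/(index_iota 0 N).
rewrite (bigID (fun i => i \in map f A)) /= [X in _ * X]big1 ?mulr1; last first.
  move=> i /=; case E : (g i) => [x|] //=.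
  by have [xA <-] := gE _ _ E; rewrite map_f.
rewrite -big_filter (perm_big (map f A)); last first.
  apply: uniq_perm; rewrite ?filter_uniq ?iota_uniq//.
    by rewrite map_inj_uniq ?fset_uniq.
  move=> i; rewrite mem_filter; apply: andb_idr => /mapP[x xA ->].
  by rewrite mem_iota add0n fN.
rewrite big_map big_seq [RHS]big_seq; apply: eq_bigr => x xA.
by rewrite gf.
Qed.
End Exists.

(* By exists_product_bernoulli the default value is never used when V is
   countable (which holds for every connected locally finite graph) and
   0 <= p <= 1. *)
Definition bernoulli_site {R : realType} {V : choiceType} (p : R) :
    probability (config V) R :=
  xget (dirac (point : config V) : probability (config V) R)
    [set P | is_product_bernoulli p P].

Lemma bernoulli_siteP {R : realType} {V : choiceType} (p : R) :
  countable [set: V] -> 0 <= p <= 1 ->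
  is_product_bernoulli p (bernoulli_site p : probability (config V) R).
Proof.
by move=> cV p01; apply: xgetPex; exact: exists_product_bernoulli.
Qed.

Section Percolation.
Context {R : realType} {V : choiceType}.
Implicit Types (e : rel V) (w : V -> bool) (x : V).

(* Empty when x is closed. *)
Definition open_cluster e w x : set V :=
  [set y | exists s : seq V, [/\ path e x s, last x s = y & all w (x :: s)]].

Definition infinite_open_cluster e w (C : set V) :=
  infinite_set C /\ exists x, C = open_cluster e w x.

Definition critical_probability e : R :=
  sup [set p : R | 0 <= p <= 1 /\
    bernoulli_site p [set w | exists C, infinite_open_cluster e w C] = 0%E].

End Percolation.

(* Main.v *)
Require Import Defs.
From mathcomp Require Import all_boot all_order all_algebra finmap zify ring lra.
From mathcomp Require Import all_classical all_reals all_analysis.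
Set Implicit Arguments.
Unset Strict Implicit.
Unset Printing Implicit Defensive.
Import Order.TTheory GRing.Theory Num.Theory.
Import numFieldNormedType.Exports.
Local Open Scope classical_set_scope.
Local Open Scope ring_scope.

(** The proof is a renormalisation along the scales L_k = l ^ (g ^ k), so that
    L_(k+1) = L_k ^ g.

    A box of centre x and scale K is good ([good]) when any two connected sets
    of extent at least K that come within 3K of x are joined by an open path
    inside the ball of radius 5K.  The sets are arbitrary, not made of open
    sites; this is what lets good boxes be chained.  A good box contains an
    open connected set of extent K starting within K of its centre
    ([good_crossing]), and this set is also large for every neighbouring box;
    hence along a path of centres of good boxes the successive open crossings
    get linked to each other ([good_chain]).

    The local isoperimetric inequality is used once ([linked_avoiding]): two
    connected sets of extent L near x cannot be separated inside B(x, 4L) by a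
    set Z of vertices that is small against a power of L, since the part
    reached from one of them without entering Z would have its whole edge
    boundary on Z.  If the bad boxes of scale K met by B(x, 4L) are covered by
    2g balls of radius 10K, then the volume upper bound makes their union such
    a Z as soon as L = K ^ g with g large, so a path of good boxes joins the two
    sets and the box of scale L is good ([good_step]).  A box that is bad at
    scale L_(k+1) therefore contains 2g bad boxes of scale L_k at mutual
    distance more than 10 L_k.

    Unfolding this down to scale L_0, where a bad box contains a closed site, a
    bad box of scale L_k contains (2g)^k distinct closed sites, arranged in one
    of at most l ^ (a (2g)^k) patterns with a independent of k ([witnesses],
    [good_of_no_witness], [size_witnesses]).  The entropy is only of the order
    of (2g)^k because log L_k grows like g^k, which is slower.  The union bound
    gives a bad box probability at most (l ^ a (1 - p)) ^ ((2g)^k), which beats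
    every power of L_k once l ^ a (1 - p) <= 1/2.  The choice of l, g and of the
    exponent depends only on the constants of the geometric hypotheses, and so
    does p_* = 1 - 1 / (2 l ^ a).

    When for every j >= k no box of scale L_j centred in B(x, 5 L_(j+1)) contains
    a closed pattern ([clean]), all these boxes are good and the open crossings at
    x of consecutive scales are linked to each other.  Any open cluster of extent
    L_k near x is linked to all of them, hence infinite ([clean_infinite]); two
    infinite clusters are both large in a good box of some scale, hence equal
    ([clean_unique_infinite]).  The probability that this fails at x decays
    faster than any power of L_k ([prob_unclean]).  Letting k go to infinity
    gives almost sure existence and uniqueness, and taking k with
    L_k ^ D <= n < L_(k+1) ^ D, where D is an exponent for the volume of balls,
    gives the decay of the law of large finite clusters, with the same threshold
    p_* for all exponents chi. *)

(** * Connected sets and the graph metric *)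

Section Walks.
Context {V : choiceType} (e : rel V).
Implicit Types (x y z : V) (D S : set V).

Definition linked D x y :=
  exists s : seq V, [/\ path e x s, last x s = y & forall z, z \in x :: s -> D z].

Definition opens (w : V -> bool) : set V := [set z | w z].

Definition linked_set S := forall x y, S x -> S y -> linked S x y.

Lemma linked_refl D x : D x -> linked D x x.
Proof. by move=> Dx; exists [::]; split=> // z; rewrite inE => /eqP->. Qed.

Lemma linked_end D x y : linked D x y -> D y.
Proof. by case=> s [_ <- h]; apply: h; exact: mem_last. Qed.

Lemma linked_start D x y : linked D x y -> D x.
Proof. by case=> s [_ _ h]; apply: h; rewrite inE eqxx. Qed.

Lemma linked_trans D y x z : linked D x y -> linked D y z -> linked D x z.
Proof.
move=> [s [ps ls hs]] [t [pt lt ht]]; exists (s ++ t); split.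
- by rewrite cat_path ps ls pt.
- by rewrite last_cat ls.
- move=> u; rewrite inE mem_cat orbA => /orP[us|ut].
    by apply: hs; rewrite inE.
  by apply: ht; rewrite inE ut orbT.
Qed.

Lemma linked_step D x y : D x -> D y -> e x y -> linked D x y.
Proof.
move=> Dx Dy exy; exists [:: y]; split=> //=; first by rewrite exy.
by move=> z; rewrite !inE => /orP[]/eqP->.
Qed.

Lemma linked_ind D (Q : V -> Prop) y :
  Q y ->
  (forall x z, D x -> e x z -> linked D z y -> Q z -> Q x) ->
  forall x, linked D x y -> Q x.
Proof.
move=> Qy IH x [s []]; elim: s x => [|z s ihs] x /=; first by move=> _ ->.
move=> /andP[exz ps] ls hs.
have hs' u : u \in z :: s -> D u by move=> us; apply: hs; rewrite inE us orbT.
apply: (IH _ z) => //; last exact: ihs.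
- by apply: hs; rewrite inE eqxx.
- by exists s.
Qed.

Lemma linked_sub D D' x y : D `<=` D' -> linked D x y -> linked D' x y.
Proof. by move=> DD' [s [ps ls hs]]; exists s; split=> // z /hs/DD'. Qed.

Hypothesis esym : symmetric e.

Lemma linked_sym D x y : linked D x y -> linked D y x.
Proof.
move=> xy; have Dy := linked_end xy; move: x xy.
apply: linked_ind; first exact: linked_refl.
move=> x z Dx exz /linked_start Dz yz; apply: linked_trans yz _.
by apply: linked_step => //; rewrite esym.
Qed.

(** The component of [x] in [D] is connected within itself, not only within
    [D]. *)
Lemma linked_set_linked D x : linked_set (linked D x).
Proof.
have from_x y : linked D x y -> linked (linked D x) x y.
  move=> xy; have Dy := linked_end xy.
  have yx := linked_sym xy.
  apply: linked_sym; move: (xy); move: y yx {Dy xy}.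
  apply: linked_ind; first by move=> h; exact: linked_refl.
  move=> y z Dy eyz zx ih xy.
  apply: linked_trans (ih (linked_sym zx)).
  by apply: linked_step => //; exact: linked_sym.
by move=> y z xy xz; apply: linked_trans (from_x _ xz); apply: linked_sym; exact: from_x.
Qed.

End Walks.

Section Metric.
Context {V : choiceType} (e : rel V).
Hypotheses (se : simple_graph e) (ce : connected_graph e).
Implicit Types (x y z : V) (D S : set V).
Local Notation d := (gdist e).

Let esym : symmetric e. Proof. by case: se. Qed.

Lemma gdistP x y :
  is_walk e x y (d x y) /\ forall m, is_walk e x y m -> (d x y <= m)%N.
Proof.
rewrite /gdist; case: xgetP => [n _ [] //|h]; exfalso.
have ex : exists n, `[< is_walk e x y n >] by have [n hn] := ce x y; exists n; apply/asboolP.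
case: (ex_minnP ex) => n /asboolP hn hmin; apply: (h n); split=> // m hm.
by apply: hmin; apply/asboolP.
Qed.

Lemma gdist_le x y n : is_walk e x y n -> (d x y <= n)%N.
Proof. exact: (gdistP x y).2. Qed.

Lemma gdist_walk x y : exists s, [/\ path e x s, last x s = y & size s = d x y].
Proof. exact: (gdistP x y).1. Qed.

Lemma gdistxx x : d x x = 0%N.
Proof. by apply/eqP; rewrite -leqn0; apply: gdist_le; exists [::]. Qed.

Lemma gdist_eq0 x y : d x y = 0%N -> x = y.
Proof. by move=> h; have [s [_ ls]] := gdist_walk x y; rewrite h -ls => /size0nil->. Qed.

Lemma gdist_triangle y x z : (d x z <= d x y + d y z)%N.
Proof.
have [s [ps ls <-]] := gdist_walk x y; have [t [pt lt <-]] := gdist_walk y z.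
apply: gdist_le; exists (s ++ t); split; last by rewrite size_cat.
- by rewrite cat_path ps ls pt.
- by rewrite last_cat ls.
Qed.

Lemma gdist_edge x y : e x y -> (d x y <= 1)%N.
Proof. by move=> exy; apply: gdist_le; exists [:: y]; split=> //=; rewrite exy. Qed.

Lemma gdist_sym x y : d x y = d y x.
Proof.
suff le u v : (d v u <= d u v)%N by apply/eqP; rewrite eqn_leq !le.
have [s [ps ls <-]] := gdist_walk u v.
apply: gdist_le; exists (rev (belast u s)); split.
- by rewrite -ls rev_path (eq_path (e' := e)) // => a b; rewrite esym.
- by case: s {ps} ls => [|a s] //= _; rewrite rev_cons last_rcons.
- by rewrite size_rev size_belast.
Qed.

Lemma gdist_pred x y n : d x y = n.+1 -> exists z, d x z = n /\ e z y.
Proof.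
move=> h; have [s [ps ls]] := gdist_walk x y; rewrite h.
case/lastP: s ps ls => [//|s y']; rewrite rcons_path last_rcons size_rcons.
move=> /andP[ps ey] yy' [sn]; subst y'; exists (last x s); split=> //.
have le1 : (d x (last x s) <= n)%N by apply: gdist_le; exists s.
have := gdist_triangle (last x s) x y; have := gdist_edge ey; lia.
Qed.

Lemma linked_ball x y r : (d x y <= r)%N -> linked e (gball e x r) x y.
Proof.
move: {2}(d x y) (erefl (d x y)) => n; elim: n y => [|n ih] y h hr.
  by rewrite -(gdist_eq0 h); apply: linked_refl; rewrite /gball /= gdistxx.
have [z [xz ezy]] := gdist_pred h.
have nr : (d x z <= r)%N by lia.
apply: linked_trans (ih z xz nr) _.
by apply: linked_step => //; rewrite /gball /= ?xz ?h.
Qed.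

Lemma linked_set_ball x r : linked_set e (gball e x r).
Proof.
move=> y z xy xz; apply: linked_trans (linked_ball xz).
by apply: (linked_sym esym); exact: linked_ball.
Qed.

(** The distance to [a] changes by at most one along an edge, so that a
    connected set meets every sphere between two of its points. *)
Lemma linked_set_gdist S a b j : linked_set e S -> S a -> S b -> (j <= d a b)%N ->
  exists2 z, S z & d a z = j.
Proof.
move=> hS Sa Sb hj; have := linked_sym esym (hS _ _ Sa Sb).
move: b Sb hj; suff: forall b, linked e S b a -> (j <= d a b)%N -> exists2 z, S z & d a z = j.
  by move=> h b _ hj /h; apply.
apply: linked_ind; first by rewrite gdistxx leqn0 => /eqP ->; exists a => //; rewrite gdistxx.
move=> x z Sx exz _ ih hj.
have [/ih //|lt] := leqP j (d a z).
exists x => //; have := gdist_triangle z a x; have := gdist_edge exz.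
rewrite (gdist_sym z x); lia.
Qed.

Hypotheses (infV : infinite_set [set: V]) (lf : locally_finite e).

Lemma finite_gball x r : finite_set (gball e x r).
Proof.
elim: r => [|r ih].
  by apply: (sub_finite_set _ (finite_set1 x)) => y; rewrite /gball /= leqn0 => /eqP/gdist_eq0 ->.
have fin : finite_set (gball e x r `|` \bigcup_(y in gball e x r) [set z | e y z]).
  by rewrite finite_setU; split=> //; apply: bigcup_finite.
apply: (sub_finite_set _ fin) => y; rewrite /gball /= leq_eqVlt => /orP[/eqP h|h]; last by left.
by right; have [z [xz ezy]] := gdist_pred h; exists z => //=; rewrite xz.
Qed.

(** Balls are finite and the graph is not, so that some vertex is further than
    [n]; the distance takes all the intermediate values. *)
Lemma gdist_surj x n : exists y, d x y = n.
Proof.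
have [y hy] : exists y, (n <= d x y)%N.
  apply: contrapT => h; apply: infV.
  apply: (sub_finite_set _ (finite_gball x n)) => y _; rewrite /gball /= leqNgt.
  by apply/negP => hy; apply: h; exists y; exact: ltnW.
have hS := @linked_set_ball x (d x y).
have [||z _ <-] := linked_set_gdist hS _ _ hy; rewrite /gball /= ?gdistxx //.
by exists z.
Qed.

Lemma countable_vertices : countable [set: V].
Proof.
have [x _] := infinite_setN0 infV.
have -> : [set: V] = \bigcup_n gball e x n.
  by apply/seteqP; split=> // y _; exists (d x y) => //=; rewrite /gball /=.
by apply: bigcup_countable => // n _; apply: finite_set_countable; exact: finite_gball.
Qed.

End Metric.

(** * Cardinals by enumeration *)

Lemma set_card_le_size (T : choiceType) (X : set T) (s : seq T) :
  (forall x, X x -> x \in s) -> (set_card X <= size s)%N.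
Proof.
move=> Xs; have finX : finite_set X by apply: sub_finite_set (finite_seq s) => x /Xs.
apply: uniq_leq_size; first exact: fset_uniq.
by move=> x; rewrite in_fset_set // inE => /Xs.
Qed.

Lemma size_le_set_card (T : choiceType) (X : set T) (s : seq T) :
  finite_set X -> uniq s -> (forall x, x \in s -> X x) -> (size s <= set_card X)%N.
Proof.
move=> finX us sX; apply: uniq_leq_size => // x /sX Xx.
by rewrite in_fset_set // inE.
Qed.

Lemma size_flatten_le (S T : eqType) (s : seq S) (f : S -> seq T) n :
  (forall x, x \in s -> (size (f x) <= n)%N) ->
  (size (flatten [seq f x | x <- s]) <= size s * n)%N.
Proof.
elim: s => //= x s ih h; rewrite size_cat mulSn leq_add //.
  by apply: h; rewrite inE eqxx.
by apply: ih => y ys; apply: h; rewrite inE ys orbT.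
Qed.

(** * Good boxes *)

Section Boxes.
Context {V : choiceType} (e : rel V).
Hypotheses (se : simple_graph e) (ce : connected_graph e)
  (infV : infinite_set [set: V]) (lf : locally_finite e).
Implicit Types (x y z : V) (D S T : set V) (w : V -> bool) (K L : nat).
Local Notation d := (gdist e).
Let esym : symmetric e. Proof. by case: se. Qed.

(** Membership of [a] and [b] measures the extent of [S] from one of its points
    near [x]; the rest of [S] may leave the box. *)
Definition fat x K S := [/\ linked_set e S &
  exists a b, [/\ S a, S b, (d x a <= 3 * K)%N & (K <= d a b)%N]].

Definition good w x K := forall S S', fat x K S -> fat x K S' ->
  exists u u', [/\ S u, S' u' & linked e (opens w `&` gball e x (5 * K)) u u'].

Lemma good_open w x K : (forall z, (d x z <= 5 * K)%N -> w z) -> good w x K.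
Proof.
move=> allw S S' [_ [a [_ [Sa _ xa _]]]] [_ [a' [_ [Sa' _ xa' _]]]].
exists a, a'; split=> //.
apply: (linked_sub (D := gball e x (5 * K))); first by move=> z h; split=> //; exact: allw.
by apply: (linked_set_ball se ce); rewrite /gball /=; lia.
Qed.

(** Goodness is applied to two balls of radius [K], one around [y] and one
    around a vertex at distance [3 * K]: the open path that joins them crosses
    the annulus between the radii [K] and [2 * K] of [y]. *)
Lemma good_crossing w y K : good w y K ->
  exists T, [/\ linked_set e T, T `<=` opens w `&` gball e y (5 * K) &
    exists a b, [/\ T a, T b, (d y a <= K)%N & (K <= d a b)%N]].
Proof.
move=> gy.
have [b yb] := gdist_surj se ce infV lf y K.
have [c yc] := gdist_surj se ce infV lf y (3 * K).
have [c' cc'] := gdist_surj se ce infV lf c K.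
have f1 : fat y K (gball e y K).
  split; first exact: linked_set_ball.
  by exists y, b; rewrite /gball /= yb gdistxx.
have f2 : fat y K (gball e c K).
  split; first exact: linked_set_ball.
  by exists c, c'; rewrite /gball /= yc gdistxx // cc'.
have [u [u' [yu cu' uu']]] := gy _ _ f1 f2.
exists (linked e (opens w `&` gball e y (5 * K)) u); split.
- exact: linked_set_linked.
- by move=> z /linked_end.
- exists u, u'; split=> //; first by apply: linked_refl; exact: linked_start uu'.
  move: yu cu'; rewrite /gball /= => yu cu'.
  have := gdist_triangle ce u y u'; have := gdist_triangle ce u' y c.
  rewrite (gdist_sym se ce u' c); lia.
Qed.

(** Induction along the path of centres.  An open crossing of the box at [z]
    starts within [K] of [z], hence within [3 * K] of any neighbour [y] of [z],
    so the good box at [y] links it to what has been reached so far. *)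
Lemma good_chain w K D Q y y' S S' : (0 < K)%N ->
  (forall z, D z -> good w z K) -> (forall z, D z -> gball e z (5 * K) `<=` Q) ->
  linked e D y y' -> fat y K S -> fat y' K S' ->
  exists u u', [/\ S u, S' u' & linked e (opens w `&` Q) u u'].
Proof.
move=> K0 Dgood DQ yy' fS fS'; have Dy' := linked_end yy'.
have sub z : D z -> opens w `&` gball e z (5 * K) `<=` opens w `&` Q.
  by move=> Dz; apply: setIS; exact: DQ.
move: y yy' S fS; apply: linked_ind.
  move=> S fS; have [u [u' [Su Su' uu']]] := Dgood _ Dy' _ _ fS fS'.
  by exists u, u'; split=> //; exact: linked_sub (sub _ Dy') uu'.
move=> y z Dy eyz /linked_start Dz ih S fS.
have [T [lT Tz [a [b [Ta Tb za ab]]]]] := good_crossing (Dgood _ Dz).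
have fT : fat z K T by split=> //; exists a, b; split=> //; lia.
have fT' : fat y K T.
  split=> //; exists a, b; split=> //.
  have := gdist_triangle ce z y a; have := gdist_edge ce eyz; lia.
have [u [t [Su Tt ut]]] := Dgood _ Dy _ _ fS fT'.
have [t' [u' [Tt' Su' tu']]] := ih _ fT.
exists u, u'; split=> //; apply: linked_trans tu'.
apply: linked_trans (linked_sub (sub _ Dy) ut) _.
by apply: linked_sub (lT _ _ Tt Tt'); apply: subset_trans (sub _ Dz).
Qed.

(** One of the two far apart points of [S] is far from [y]. *)
Lemma fat_local x L S K y : fat x L S -> S y -> (2 * K <= L)%N -> fat y K S.
Proof.
move=> [lS [a [b [Sa Sb _ ab]]]] Sy KL; split=> //.
have h := gdist_triangle ce y a b; rewrite (gdist_sym se ce a y) in h.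
have [ya|ya] := leqP K (d y a); first by exists y, a; rewrite gdistxx //.
by exists y, b; rewrite gdistxx //; split=> //; lia.
Qed.

(** [S] meets the [L + 1] spheres of radius at most [L] around [a], all of them
    inside the ball. *)
Lemma fat_card x L S : fat x L S -> (L < set_card (S `&` gball e x (4 * L)))%N.
Proof.
move=> [lS [a [b [Sa Sb xa ab]]]].
have pt j : exists z, (j <= L)%N -> S z /\ d a z = j.
  have [jL|jL] := leqP j L; last by exists a => ?; lia.
  by have [z Sz az] := linked_set_gdist se ce lS Sa Sb (leq_trans jL ab); exists z.
have [f fP] := choice pt.
have -> : L.+1 = size (map f (iota 0 L.+1)) by rewrite size_map size_iota.
apply: size_le_set_card.
- by apply: sub_finite_set (finite_gball ce lf x (4 * L)) => z [].
- rewrite map_inj_in_uniq ?iota_uniq // => i j; rewrite !mem_iota => iL jL ij.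
  have [_ <-] : S (f i) /\ d a (f i) = i by apply: fP; lia.
  have [_ <-] : S (f j) /\ d a (f j) = j by apply: fP; lia.
  by rewrite ij.
- move=> z /mapP[j]; rewrite mem_iota => jL ->.
  have [Sj aj] : S (f j) /\ d a (f j) = j by apply: fP; lia.
  split=> //; rewrite /gball /=; have := gdist_triangle ce a x (f j); lia.
Qed.

Lemma card_edges_le (X : set {fset V}) (Z : {fset V}) Delta :
  (forall x, (set_card (gball e x 1) <= Delta)%N) ->
  (forall E, X E -> exists a b, [/\ b \in Z, e b a & E = [fset a; b]%fset]) ->
  (set_card X <= #|` Z| * Delta)%N.
Proof.
move=> deg XZ.
pose s := flatten [seq [seq [fset a; b]%fset | a <- enum_fset (fset_set (gball e b 1))] | b <- enum_fset Z].
apply: (@leq_trans (size s)); last first.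
  by apply: size_flatten_le => b _; rewrite size_map; exact: deg.
apply: set_card_le_size => E /XZ[a [b [bZ eba ->]]].
apply/flatten_mapP; exists b => //; apply/mapP; exists a => //.
rewrite in_fset_set; last exact: finite_gball.
by rewrite inE /=; exact: gdist_edge.
Qed.

Context {R : realType} (di ci : R).
Hypotheses (hdi : 1 < di) (hci : 0 < ci) (iso : local_isoperimetry di ci e).

(** The set [A] of the vertices reached from [S] in the ball without entering [Z]
    has all its boundary edges on [Z].  If [A] misses [S'], then [A] and its
    complement in the ball both have at least [L / 2] vertices; the isoperimetric
    inequality for the smaller of the two contradicts the size of [Z]. *)
Lemma linked_avoiding x L S S' (Z : {fset V}) m Delta : (0 < L)%N ->
  (forall x, (set_card (gball e x 1) <= Delta)%N) ->
  (#|` Z| <= m)%N -> (2 * m <= L)%N ->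
  (m * Delta)%:R < ci * (L%:R / 2) `^ ((di - 1) / di) ->
  fat x L S -> fat x L S' ->
  exists y y', [/\ S y, S' y' &
    linked e (gball e x (4 * L) `&` [set z | z \notin Z]) y y'].
Proof.
move=> L0 deg Zm mL num fS fS'.
set B := gball e x (4 * L); set D := _ `&` _.
pose A := [set z | exists2 y, S y & linked e D y z].
apply: contrapT => no.
have finB : finite_set B by exact: finite_gball.
have AB : A `<=` B by move=> z [y _ /linked_end[]].
have finA := sub_finite_set AB finB.
have finC : finite_set (B `\` A) by apply: sub_finite_set finB => z [].
have L4 : (1 <= 4 * L)%N by lia.
have bd u v : A u -> (B `\` A) v -> e u v -> v \in Z.
  move=> [y Sy yu] [Bv nAv] euv; apply: contrapT => /negP vZ; apply: nAv.
  have Du := linked_end yu; have Dv : D v by split=> //; exact/negP.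
  by exists y => //; apply: linked_trans yu _; exact: linked_step.
have cS := fat_card fS; have cS' := fat_card fS'.
have cA : (L < set_card A + m)%N.
  have : (set_card (S `&` B) <= set_card A + #|` Z|)%N.
    rewrite -[X in (_ <= X)%N](size_cat (enum_fset (fset_set A)) (enum_fset Z)).
    apply: set_card_le_size => z [Sz Bz]; rewrite mem_cat.
    case zZ: (z \in Z); first by rewrite orbT.
    rewrite orbF in_fset_set // inE; exists z => //.
    by apply: linked_refl; split=> //=; rewrite zZ.
  move: cS Zm; rewrite -/B; lia.
have cC : (L < set_card (B `\` A))%N.
  apply: leq_trans cS' _; rewrite -/B.
  apply: set_card_le_size => z [Sz Bz]; rewrite in_fset_set // inE; split=> // -[y Sy yz].
  by apply: no; exists y, z.
(* The contradiction, for either of the two candidates A and B \ A. *)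
have final A' : A' `<=` B -> (set_card A')%:R <= (set_card B)%:R / 2 :> R ->
    (L <= 2 * set_card A')%N ->
    (forall u v, A' u -> (B `\` A') v -> e u v -> u \in Z \/ v \in Z) -> False.
  move=> A'B half big bd'.
  have := iso L4 A'B half.
  suff : (set_card (edge_boundary e B A') <= m * Delta)%N.
    rewrite -(ler_nat R) => le1 le2.
    have le0 : ci * (L%:R / 2) `^ ((di - 1) / di) <=
        ci * (set_card A')%:R `^ ((di - 1) / di).
      rewrite ler_wpM2l ?(ltW hci) // ge0_ler_powR //.
      - by rewrite divr_ge0 ?subr_ge0 ?(ltW hdi) // ltW // (lt_trans ltr01 hdi).
      - by rewrite nnegrE divr_ge0.
      - by rewrite nnegrE.
      - by rewrite ler_pdivrMr // -natrM ler_nat mulnC.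
    by have := lt_le_trans num (le_trans le0 (le_trans le2 le1)); rewrite ltxx.
  apply: leq_trans (leq_mul Zm (leqnn Delta)); apply: card_edges_le => // E.
  move=> [u [v [A'u BA'v euv ->]]].
  have [uZ|vZ] := bd' _ _ A'u BA'v euv.
    by exists v, u; split=> //; rewrite fsetUC.
  by exists u, v; split=> //; rewrite esym.
have [half|half] := leP ((set_card A)%:R : R) ((set_card B)%:R / 2).
  apply: (final A) => //; first by lia.
  by move=> u v Au BAv euv; right; exact: bd BAv euv.
apply: (final (B `\` A)).
- by move=> z [].
- have : (set_card (B `\` A) + set_card A <= set_card B)%N.
    rewrite -[X in (X <= _)%N](size_cat (enum_fset (fset_set (B `\` A))) (enum_fset (fset_set A))).
    apply: size_le_set_card => //.
      rewrite cat_uniq !fset_uniq andbT /=; apply/hasPn => z /=.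
      by rewrite !in_fset_set // !inE => Az; apply/negP; rewrite inE => -[].
    by move=> z; rewrite mem_cat !in_fset_set // => /orP[]; rewrite inE; [case|move/AB].
  rewrite -(ler_nat R) natrD; lra.
- by lia.
- move=> u v [Bu nAu] [Bv nv] euv; left; apply: (bd v u) => //; last by rewrite esym.
  by apply: contrapT => nAv; apply: nv.
Qed.

End Boxes.

(** * From one scale to the next *)

Section Packing.
Context {V : choiceType} (e : rel V).

(** Greedy choice: a family of far apart points that cannot be extended has all
    the others within [r]. *)
Lemma packing_or_cover (P : V -> Prop) r N :
  (exists ys : seq V, [/\ size ys = N, forall y, y \in ys -> P y &
     pairwise (fun y z => (r < gdist e y z)%N) ys]) \/
  (exists zs : seq V, (size zs < N)%N /\
     forall y, P y -> exists2 z, z \in zs & (gdist e y z <= r)%N).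
Proof.
elim: N => [|N [[ys [sz Pys far]]|[zs [sz cov]]]].
- by left; exists [::].
- have [[y [Py yfar]]|no] := pselect (exists y, P y /\ forall z, z \in ys -> (r < gdist e y z)%N).
    left; exists (y :: ys); rewrite /= sz far; split=> //.
      by move=> z; rewrite inE => /orP[/eqP ->|/Pys].
    by rewrite andbT; apply/allP => z /yfar.
  right; exists ys; rewrite sz; split=> // y Py; apply: contrapT => h; apply: no.
  exists y; split=> // z zys; rewrite ltnNge; apply/negP => le; apply: h.
  by exists z.
- by right; exists zs; split=> //; exact: ltnW.
Qed.

End Packing.

Section Step.
Context {V : choiceType} (e : rel V).
Hypotheses (se : simple_graph e) (ce : connected_graph e)
  (infV : infinite_set [set: V]) (lf : locally_finite e).
Implicit Types (x y z : V) (w : V -> bool) (K L : nat) (F : {fset V}).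
Local Notation d := (gdist e).
Context {R : realType} (di ci : R).
Hypotheses (hdi : 1 < di) (hci : 0 < ci) (iso : local_isoperimetry di ci e).

(** [zs] are the centres of balls that cover the bad boxes of scale [K]; the path
    given by the isoperimetric inequality, which avoids these balls, runs through
    good boxes only. *)
Lemma good_step w x K L N b (zs : seq V) :
  (0 < K)%N -> (5 * K <= L)%N -> (size zs <= N)%N ->
  (forall y, (set_card (gball e y (10 * K)) <= b)%N) ->
  (2 * (N * b) <= L)%N ->
  (N * b * b)%:R < ci * (L%:R / 2) `^ ((di - 1) / di) ->
  (forall y, (d x y <= 4 * L)%N /\ ~ good e w y K ->
     exists2 z, z \in zs & (d y z <= 10 * K)%N) ->
  good e w x L.
Proof.
move=> K0 KL szN bb NbL num cov S S' fS fS'.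
pose s := flatten [seq enum_fset (fset_set (gball e z (10 * K))) | z <- zs].
pose Z : {fset V} := [fset z in s]%fset.
have sZ : (size s <= N * b)%N.
  apply: leq_trans (size_flatten_le (n := b) _) _; first by move=> y _; exact: bb.
  by rewrite leq_mul2r szN orbT.
have Zm : (#|` Z| <= N * b)%N.
  by apply: leq_trans sZ; apply: uniq_leq_size => // z; rewrite inE.
have deg y : (set_card (gball e y 1) <= b)%N.
  apply: leq_trans (bb y); apply: set_card_le_size => z yz.
  rewrite in_fset_set; last exact: finite_gball.
  by rewrite inE /gball /=; move: yz; rewrite /gball /=; lia.
have L0 : (0 < L)%N by lia.
have [y [y' [Sy Sy' yy']]] :=
  linked_avoiding se ce lf hdi hci iso L0 deg Zm NbL num fS fS'.
have KL2 : (2 * K <= L)%N by lia.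
apply: (good_chain se ce infV lf K0 _ _ yy'
  (fat_local se ce fS Sy KL2) (fat_local se ce fS' Sy' KL2)).
- move=> z [xz zZ]; apply: contrapT => bad.
  have [|u uz zu] := cov z; first by split.
  move/negP: zZ; apply; rewrite inE; apply/flatten_mapP; exists u => //.
  rewrite in_fset_set; last exact: finite_gball.
  by rewrite inE /gball /= (gdist_sym se ce).
- move=> z [xz _] u; move: xz; rewrite /gball /= => xz zu.
  have := gdist_triangle ce z x u; lia.
Qed.

End Step.


(** * Patterns of closed sites in a bad box *)

Section Witnesses.
Context {V : choiceType} (e : rel V).
Hypotheses (ce : connected_graph e) (lf : locally_finite e).
Implicit Types (x y z : V) (w : V -> bool) (F : {fset V}).
Local Notation d := (gdist e).

Definition witnessed w (Fs : seq {fset V}) :=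
  exists2 F, F \in Fs & forall z, z \in F -> ~~ w z.

Fixpoint unions (U : seq {fset V}) n : seq {fset V} :=
  if n is n'.+1 then [seq (F `|` G)%fset | F <- U, G <- unions U n'] else [:: fset0].

Lemma size_unions U n : size (unions U n) = (size U ^ n)%N.
Proof. by elim: n => //= n ih; rewrite size_allpairs ih expnS. Qed.

Lemma unions_sub U n F z : F \in unions U n -> z \in F -> exists2 G, G \in U & z \in G.
Proof.
elim: n F => [|n ih] F /=; first by rewrite inE => /eqP ->.
move=> /allpairsP[[G H] /= [GU HU ->]]; rewrite inE => /orP[zG|/ih]; first by exists G.
exact.
Qed.

Context (l g D : nat).
Hypotheses (l10 : (10 <= l)%N) (g2 : (2 <= g)%N)
  (vol : forall x K, (l <= K)%N -> (set_card (gball e x (10 * K)) <= K ^ D)%N).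

Definition scale k := (l ^ (g ^ k))%N.

Definition ball_seq x r : seq V := enum_fset (fset_set (gball e x r)).

Lemma mem_ball_seq x r y : (y \in ball_seq x r) = (d x y <= r)%N.
Proof.
rewrite /ball_seq in_fset_set; last exact: finite_gball.
by apply/idP/idP; rewrite inE.
Qed.

(** The sets of sites one of which is entirely closed when the box is bad.  A
    union of [2 * g] patterns of [(2 * g) ^ k'] sites each has
    [(2 * g) ^ k] sites exactly when they are pairwise disjoint: the filter stands
    for this condition. *)
Fixpoint witnesses k x : seq {fset V} :=
  if k is k'.+1 then
    [seq F <- unions (flatten [seq witnesses k' y | y <- ball_seq x (4 * scale k)]) (2 * g)
       | #|` F| == ((2 * g) ^ k)%N]
  else [seq [fset y]%fset | y <- ball_seq x (5 * scale 0)].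

Lemma scaleS k : scale k.+1 = (scale k ^ g)%N.
Proof. by rewrite /scale expnSr expnM. Qed.

Lemma scale_ge k : (l <= scale k)%N.
Proof.
rewrite /scale -[X in (X <= _)%N]expn1 leq_exp2l; last by lia.
by rewrite expn_gt0; lia.
Qed.

Lemma scaleS_ge k : (10 * scale k <= scale k.+1)%N.
Proof.
have h := scale_ge k; rewrite scaleS.
apply: (@leq_trans (scale k ^ 2)); first by rewrite expnS expn1 leq_mul2r; lia.
by rewrite leq_pexp2l //; lia.
Qed.

Lemma card_witness k x F : F \in witnesses k x -> #|` F| = ((2 * g) ^ k)%N.
Proof.
case: k => [|k] /=; last by rewrite mem_filter => /andP[/eqP].
by move=> /mapP[y _ ->]; rewrite cardfs1.
Qed.

Lemma witness_ball k x F z : F \in witnesses k x -> z \in F -> (d x z <= 5 * scale k)%N.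
Proof.
elim: k x F => [|k ih] x F /=.
  by move=> /mapP[y yx ->]; rewrite inE => /eqP ->; move: yx; rewrite mem_ball_seq.
rewrite mem_filter => /andP[_ FU] zF; have [G /flatten_mapP[y yx Gy] zG] := unions_sub FU zF.
move: yx; rewrite mem_ball_seq => xy.
have := ih _ _ Gy zG; have := gdist_triangle ce y x z; have := scaleS_ge k; lia.
Qed.

Lemma size_ball_seq j r z : (r <= 10 * scale j)%N ->
  (size (ball_seq z r) <= l ^ (D * g ^ j))%N.
Proof.
move=> hr; have -> : (l ^ (D * g ^ j) = scale j ^ D)%N by rewrite /scale -expnM mulnC.
apply: leq_trans (vol z (scale_ge j)); apply: uniq_leq_size; first exact: fset_uniq.
by move=> u; rewrite mem_ball_seq -/(ball_seq _ _) mem_ball_seq; lia.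
Qed.

(** With M_k the number of patterns, M_(k+1) <= (L_(k+1) ^ D * M_k) ^ (2 g).
    With L_k = l ^ (g ^ k) and M_0 <= l ^ D this yields
    M_k <= l ^ (a (2 g) ^ k - 2 D g ^ (k+1)) for a = D (2 g + 1); the induction
    carries the negative term, moved to the left-hand side. *)
Lemma size_witnesses k x :
  (size (witnesses k x) <= l ^ (D * (2 * g).+1 * (2 * g) ^ k))%N.
Proof.
have l0 : (0 < l)%N by lia.
suff h y : (size (witnesses k y) * l ^ (2 * D * g ^ k.+1) <= l ^ (D * (2 * g).+1 * (2 * g) ^ k))%N.
  by apply: leq_trans (h x); rewrite leq_pmulr // expn_gt0 l0.
elim: k y => [|k ih] y.
  rewrite /= size_map.
  apply: leq_trans (leq_mul (size_ball_seq (j := 0) y _) (leqnn _)) _; first by lia.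
  by rewrite -expnD leq_exp2l; lia.
pose M := (l ^ (D * (2 * g).+1 * (2 * g) ^ k))%N.
rewrite /= size_filter; apply: leq_trans (leq_mul (count_size _ _) (leqnn _)) _.
rewrite size_unions.
set U := flatten _.
have hU : (size U * l ^ (2 * D * g ^ k.+1) <= l ^ (D * g ^ k.+1) * M)%N.
  have [s hs] : exists s, s = ball_seq y (4 * scale k.+1) by eexists.
  have sz : (size U * l ^ (2 * D * g ^ k.+1) <= size s * M)%N.
    rewrite /U -hs; elim: s {hs U} => //= z s ihs.
    by rewrite size_cat mulnDl mulSn leq_add //; exact: ih.
  apply: leq_trans sz _; rewrite leq_mul2r hs size_ball_seq ?orbT //; lia.
have e1 : ((l ^ (D * g ^ k.+1)) ^ (2 * g) * l ^ (2 * D * g ^ k.+2) = (l ^ (2 * D * g ^ k.+1)) ^ (2 * g))%N.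
  by rewrite -!expnM -expnD; congr (l ^ _)%N; rewrite !expnS; ring.
have e2 : (M ^ (2 * g) = l ^ (D * (2 * g).+1 * (2 * g) ^ k.+1))%N.
  by rewrite /M -expnM; congr (l ^ _)%N; rewrite !expnS; ring.
rewrite -e2 -(leq_pmul2r (m := (l ^ (D * g ^ k.+1)) ^ (2 * g))) ?expn_gt0 ?l0 //.
rewrite -mulnA (mulnC (l ^ _)%N) e1 -!expnMn (mulnC M).
by rewrite leq_exp2r //; lia.
Qed.

Definition bad_witness w k y := witnessed w (witnesses k y).

(** The patterns of all the boxes needed to go from scale [k] to scale [k.+1]
    around [x]. *)
Definition shell k x : seq {fset V} :=
  flatten [seq witnesses k y | y <- ball_seq x (5 * scale k.+1)].

Definition clean w k x := forall j, (k <= j)%N -> ~ witnessed w (shell j x).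

Lemma card_shell k x F : F \in shell k x -> #|` F| = ((2 * g) ^ k)%N.
Proof. by move=> /flatten_mapP[y _]; exact: card_witness. Qed.

Lemma size_shell k x :
  (size (shell k x) <= l ^ (D * g ^ k.+1) * l ^ (D * (2 * g).+1 * (2 * g) ^ k))%N.
Proof.
apply: leq_trans (size_flatten_le (n := l ^ (D * (2 * g).+1 * (2 * g) ^ k)) _) _.
  by move=> y _; exact: size_witnesses.
by rewrite leq_mul2r size_ball_seq ?orbT // leq_mul2r orbT.
Qed.

Lemma leq_scale k : (k <= scale k)%N.
Proof.
apply: leq_trans (_ : g ^ k <= _)%N; first by rewrite ltnW // ltn_expl.
by rewrite ltnW // ltn_expl //; lia.
Qed.

Hypothesis se : simple_graph e.

(** Patterns of boxes of scale [k] lie within [5 * scale k] of the centres, so they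
    are disjoint when the centres are more than [10 * scale k] apart. *)
Lemma glue_witnesses w k x (ys : seq V) :
  (forall y, y \in ys -> (d x y <= 4 * scale k.+1)%N /\ bad_witness w k y) ->
  pairwise (fun y z => (10 * scale k < d y z)%N) ys ->
  exists F, [/\ F \in unions (flatten [seq witnesses k y | y <- ball_seq x (4 * scale k.+1)]) (size ys),
    #|` F| = (size ys * (2 * g) ^ k)%N, forall z, z \in F -> ~~ w z &
    forall z, z \in F -> exists2 y, y \in ys & (d y z <= 5 * scale k)%N].
Proof.
set U := flatten _; elim: ys => [|y ys ih] h.
  by exists fset0; rewrite cardfs0 mul0n; split=> //; rewrite inE.
rewrite /= => /andP[/allP far pw].
have [|F [FU cF clF nF]] := ih _ pw.
  by move=> z zys; apply: h; rewrite inE zys orbT.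
have [xy [G Gy clG]] := h y (mem_head _ _).
exists (G `|` F)%fset; split.
- apply/allpairsP; exists (G, F); split=> //=; apply/flatten_mapP; exists y => //.
  by rewrite mem_ball_seq.
- rewrite cardfsU; have -> : (G `&` F = fset0)%fset.
    apply/fsetP => z; rewrite !inE; apply/negP => /andP[zG /nF[u uys uz]].
    have := far _ uys; have := witness_ball Gy zG; have := gdist_triangle ce z y u.
    rewrite (gdist_sym se ce z u); lia.
  by rewrite cardfs0 subn0 cF (card_witness Gy) mulSn.
- by move=> z; rewrite inE => /orP[/clG|/clF].
- move=> z; rewrite inE => /orP[zG|/nF[u uys uz]].
    by exists y; rewrite ?inE ?eqxx //; exact: witness_ball Gy zG.
  by exists u; rewrite ?inE ?uys ?orbT.
Qed.

End Witnesses.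


(** * Good boxes at all scales and infinite clusters *)

Section Renormalisation.
Context {V : choiceType} (e : rel V).
Hypotheses (se : simple_graph e) (ce : connected_graph e)
  (infV : infinite_set [set: V]) (lf : locally_finite e).
Implicit Types (x y z : V) (w : V -> bool) (F : {fset V}).
Local Notation d := (gdist e).
Context {R : realType} (di ci : R).
Hypotheses (hdi : 1 < di) (hci : 0 < ci) (iso : local_isoperimetry di ci e).
Context (l g D : nat).
Hypotheses (l10 : (10 <= l)%N) (g2 : (2 <= g)%N)
  (vol : forall x K, (l <= K)%N -> (set_card (gball e x (10 * K)) <= K ^ D)%N)
(numN : forall K, (l <= K)%N -> (2 * (2 * g * K ^ D) <= K ^ g)%N)
  (numR : forall K, (l <= K)%N ->
    (2 * g * K ^ D * K ^ D)%:R < ci * ((K ^ g)%:R / 2) `^ ((di - 1) / di)).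
Local Notation scale := (scale l g).
Local Notation bad_witness := (bad_witness e l g).
Local Notation shell := (shell e l g).
Local Notation clean := (clean e l g).

(** Either [2 * g] bad boxes of scale [k] are far apart, and their patterns
    together form a pattern of scale [k.+1], or fewer than [2 * g] balls cover
    all of them. *)
Lemma good_of_no_witness w k x : ~ bad_witness w k x -> good e w x (scale k).
Proof.
elim: k x => [|k ih] x nw.
  apply: (good_open se ce) => z xz; apply: contrapT => /negP wz; apply: nw.
  exists [fset z]%fset; last by move=> u; rewrite inE => /eqP ->.
  by apply/mapP; exists z => //; rewrite (mem_ball_seq ce lf).
have sk := scale_ge l10 g2 k; have sk1 := scaleS_ge l10 g2 k.
pose P y := (d x y <= 4 * scale k.+1)%N /\ bad_witness w k y.
have [[ys [sz Pys far]]|[zs [sz cov]]] := packing_or_cover e P (10 * scale k) (2 * g).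
  have [F [FU cF clF _]] := glue_witnesses ce lf l10 g2 se Pys far.
  exfalso; apply: nw; exists F => //=.
  by rewrite mem_filter cF sz -expnS eqxx /=; move: FU; rewrite sz.
apply: (good_step se ce infV lf hdi hci iso (K := scale k) (N := 2 * g) (b := scale k ^ D) (zs := zs)); try lia.
- by move=> y; exact: vol.
- by rewrite scaleS; exact: numN.
- by rewrite scaleS; exact: numR.
- move=> y [xy nb]; apply: cov; split=> //; apply: contrapT => nb'; apply: nb; exact: ih.
Qed.


Lemma open_clusterE w x : open_cluster e w x = linked e (opens w) x.
Proof.
apply/seteqP; split=> y [s [ps ls hs]]; exists s; split=> //.
  by move=> z zs; exact: (allP hs).
by apply/allP => z zs; exact: hs.
Qed.

Lemma infinite_far C x n : infinite_set C -> exists2 b, C b & (n <= d x b)%N.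
Proof.
move=> infC; apply: contrapT => no; apply: infC.
apply: (sub_finite_set _ (finite_gball ce lf x n)) => b Cb.
by rewrite /gball /= leqNgt; apply/negP => h; apply: no; exists b => //; exact: ltnW.
Qed.

Lemma clean_good w k x j y : clean w k x -> (k <= j)%N -> (d x y <= 5 * scale j.+1)%N ->
  good e w y (scale j).
Proof.
move=> cl kj xy; apply: good_of_no_witness => -[F Fy clF]; apply: (cl j kj).
by exists F => //; apply/flatten_mapP; exists y => //; rewrite (mem_ball_seq ce lf).
Qed.

(** The crossing [T'] of the box at [x] of scale [j.+1] has a point [a] within
    [scale j.+1] of [x]; a chain of good boxes of scale [j] from [x] to [a] links
    [T'] to the crossing found at scale [j]. *)
Lemma clean_climb w k x S u j : clean w k x -> (k <= j)%N ->
  fat e x (scale k) S -> S `<=` opens w -> S u ->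
  exists T, fat e x (scale j) T /\ exists2 t, T t & linked e (opens w) u t /\ T `<=` opens w.
Proof.
move=> cl + fS Sw Su; elim: j => [|j ih].
  rewrite leqn0 => /eqP k0; exists S; split; first by rewrite -k0.
  by exists u => //; split=> //; apply: linked_refl; exact: Sw.
rewrite leq_eqVlt => /orP[/eqP kj|kj].
  exists S; split; first by rewrite -kj.
  by exists u => //; split=> //; apply: linked_refl; exact: Sw.
have [T [fT [t Tt [ut Tw]]]] := ih kj.
have sj := scaleS_ge l10 g2 j; have sj1 := scale_ge l10 g2 j.
have gx : good e w x (scale j.+1) by apply: clean_good cl _ _; [lia|rewrite gdistxx].
have [T' [lT' T'w [a [b [T'a T'b xa ab]]]]] := good_crossing se ce infV lf gx.
have fT' : fat e x (scale j.+1) T' by split=> //; exists a, b; split=> //; lia.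
have K0 : (0 < scale j)%N by lia.
have K2 : (2 * scale j <= scale j.+1)%N by lia.
have gD z : gball e x (scale j.+1) z -> good e w z (scale j).
  by rewrite /gball /= => xz; apply: clean_good cl kj _; lia.
have [t1 [t2 [Tt1 T't2 t12]]] := good_chain se ce infV lf (w := w) (Q := setT) K0
  gD (fun z _ => @subsetT _ _)
  (linked_ball ce xa) fT (fat_local se ce fT' T'a K2).
exists T'; split=> //; exists t2 => //; split; last by move=> z /T'w[].
apply: linked_trans ut _; have [lT _] := fT.
apply: linked_trans (linked_sub Tw (lT _ _ Tt Tt1)) _.
by apply: linked_sub t12 => z [].
Qed.

(** A finite cluster would be bounded, while the cluster of [u] contains sets of
    every extent. *)
Lemma clean_infinite w k x S u : clean w k x -> fat e x (scale k) S -> S `<=` opens w -> S u ->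
  infinite_set (open_cluster e w u).
Proof.
move=> cl fS Sw Su finC.
pose M := \max_(z <- enum_fset (fset_set (open_cluster e w u))) d u z.
have dM z : linked e (opens w) u z -> (d u z <= M)%N.
  by move=> uz; apply: leq_bigmax_seq => //; rewrite in_fset_set // inE open_clusterE.
have [T [[lT [a [b [Ta Tb _ ab]]]] [t Tt [ut Tw]]]] :=
  clean_climb cl (leq_addr (2 * M).+1 k) fS Sw Su.
have uT z : T z -> linked e (opens w) u z.
  by move=> Tz; apply: linked_trans ut _; exact: linked_sub Tw (lT _ _ Tt Tz).
have := dM _ (uT _ Ta); have := dM _ (uT _ Tb); have := gdist_triangle ce u a b.
rewrite (gdist_sym se ce a u); have := leq_scale l10 g2 (k + (2 * M).+1); lia.
Qed.

Lemma linked_cluster w x : linked_set e (open_cluster e w x).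
Proof. by rewrite open_clusterE; apply: linked_set_linked; case: se. Qed.

Lemma sub_cluster w x : open_cluster e w x `<=` opens w.
Proof. by rewrite open_clusterE => z /linked_end. Qed.

Lemma cluster_self w x y : open_cluster e w x y -> open_cluster e w x x.
Proof. by rewrite open_clusterE => /linked_start wx; exact: linked_refl. Qed.

Lemma cluster_eq w x y : linked e (opens w) x y -> open_cluster e w x = open_cluster e w y.
Proof.
have [es _] := se.
move=> xy; rewrite !open_clusterE; apply/seteqP; split=> z.
  by apply: linked_trans; exact: linked_sym.
exact: linked_trans.
Qed.

Lemma clean_unique_infinite w k x : clean w k x -> exists! C, infinite_open_cluster e w C.
Proof.
move=> cl.
have gx j : (k <= j)%N -> good e w x (scale j).
  by move=> kj; apply: clean_good cl kj _; rewrite gdistxx.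
have [T [lT Tw [a [b [Ta Tb xa ab]]]]] := good_crossing se ce infV lf (gx k (leqnn k)).
have fT : fat e x (scale k) T by split=> //; exists a, b; split=> //; lia.
exists (open_cluster e w a); split.
  split; last by exists a.
  by apply: clean_infinite cl fT _ Ta => z /Tw[].
(* A scale is chosen at which the starting points of both clusters lie near x. *)
have uniq u v : infinite_set (open_cluster e w u) -> infinite_set (open_cluster e w v) ->
    open_cluster e w u = open_cluster e w v.
  move=> iu iv; pose j := (k + (d x u + d x v))%N.
  have jj := leq_scale l10 g2 j.
  have fu y : (d x y <= j)%N -> infinite_set (open_cluster e w y) ->
      fat e x (scale j) (open_cluster e w y).
    move=> xy iy; split; first exact: linked_cluster.
    have [c yc cd] := infinite_far y (scale j) iy.
    by exists y, c; split=> //; [exact: cluster_self yc|lia].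
  have [||y [z [uy vz yz]]] := gx j (leq_addr _ _) _ _ (fu u _ iu) (fu v _ iv); try by rewrite /j; lia.
  have yz' : linked e (opens w) y z by apply: linked_sub yz => ? [].
  move: (uy) (vz); rewrite !open_clusterE => uy' vz'; rewrite -!open_clusterE.
  by rewrite (cluster_eq uy') (cluster_eq yz') (cluster_eq vz').
move=> C [iC [u Cu]]; rewrite Cu in iC *; apply: uniq => //.
by apply: clean_infinite cl fT _ Ta => z /Tw[].
Qed.

Lemma clean_no_large_finite w k x n : clean w k x -> (set_card (gball e x (scale k)) <= n)%N ->
  ~ (finite_set (open_cluster e w x) /\ (n < set_card (open_cluster e w x))%N).
Proof.
move=> cl bn [finC nC].
have [b Cb xb] : exists2 b, open_cluster e w x b & (scale k <= d x b)%N.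
  apply: contrapT => no; have : (set_card (open_cluster e w x) <= set_card (gball e x (scale k)))%N.
    apply: set_card_le_size => z Cz; rewrite in_fset_set; last exact: finite_gball.
    by rewrite inE /gball /= leqNgt; apply/negP => h; apply: no; exists z => //; exact: ltnW.
  lia.
have Cx := cluster_self Cb.
suff : infinite_set (open_cluster e w x) by [].
apply: (clean_infinite (S := open_cluster e w x) cl) => //; last exact: sub_cluster.
by split; [exact: linked_cluster|exists x, b; rewrite gdistxx].
Qed.

End Renormalisation.

(** * Measurability and the union bound *)

Section Sites.
Context {V : choiceType}.
Hypothesis cV : countable [set: V].

Lemma measurable_exists_vertex (Q : V -> Prop) (F : V -> set (config V)) :
  (forall x, measurable (F x)) -> measurable [set w | exists2 x, Q x & F x w].
Proof.
move=> mF.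
have -> : [set w | exists2 x, Q x & F x w] = \bigcup_x (F x `&` [set _ | Q x]).
  by apply/seteqP; split=> [w [x Qx Fx]|w [x _ [Fx Qx]]]; exists x.
apply: countable_bigcupT_measurable => // x; apply: measurableI => //.
have [Qx|nQx] := pselect (Q x).
  by have -> : [set _ | Q x] = setT :> set (config V) by apply/seteqP; split.
by have -> : [set _ | Q x] = set0 :> set (config V) by apply/seteqP; split.
Qed.

Lemma measurable_forall_vertex (Q : V -> Prop) (F : V -> set (config V)) :
  (forall x, measurable (F x)) -> measurable [set w | forall x, Q x -> F x w].
Proof.
move=> mF.
have -> : [set w | forall x, Q x -> F x w] = ~` [set w | exists2 x, Q x & (~` F x) w].
  apply/seteqP; split=> w h; first by move=> [x /h].
  by move=> x Qx; apply: contrapT => nF; apply: h; exists x.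
apply: measurableC; apply: (@measurable_exists_vertex _ (fun x => ~` F x)) => x.
exact: measurableC.
Qed.

Lemma measurable_open x : measurable [set w : config V | w x].
Proof. by apply: sub_sigma_algebra; exists x, true. Qed.

Lemma measurable_closed (F : {fset V}) :
  measurable [set w : config V | forall z, z \in F -> ~~ w z].
Proof.
apply: (@measurable_forall_vertex _ (fun z => [set w : config V | ~~ w z])) => x.
have -> : [set w : config V | ~~ w x] = ~` [set w : config V | w x].
  by apply/seteqP; split=> w /= /negP.
exact: measurableC (measurable_open x).
Qed.

Lemma measurable_witnessed (Fs : seq {fset V}) :
  measurable [set w : config V | witnessed w Fs].
Proof.
have -> : [set w : config V | witnessed w Fs] =
    \bigcup_(F in [set` Fs]) [set w : config V | forall z, z \in F -> ~~ w z].
  by apply/seteqP; split=> [w [F FFs h]|w [F FFs h]]; exists F.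
by apply: fin_bigcup_measurable => // F _; exact: measurable_closed.
Qed.

Section Graph.
Variable e : rel V.
Hypotheses (se : simple_graph e) (ce : connected_graph e) (lf : locally_finite e).

Lemma measurable_linked x y : measurable [set w : config V | linked e (opens w) x y].
Proof.
(* Events about paths of a given length, by induction on the length. *)
pose F n x := [set w : config V | exists s, [/\ path e x s, last x s = y, size s = n &
  forall z, z \in x :: s -> opens w z]].
have mF n : forall x, measurable (F n x).
  elim: n => [|n ih] {}x.
    have [xy|xy] := eqVneq x y.
      have -> : F 0%N x = [set w : config V | w x].
        apply/seteqP; split=> w; first by move=> [s [_ _ _ h]]; apply: h; rewrite mem_head.
        by move=> wx; exists [::]; split=> // z; rewrite inE => /eqP ->.
      exact: measurable_open.
    have -> : F 0%N x = set0.
      apply/seteqP; split=> // w [s [_ + /size0nil s0 _]].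
      by rewrite s0 => /eqP; rewrite (negbTE xy).
    exact: measurable0.
  have -> : F n.+1 x = [set w : config V | w x] `&` [set w | exists2 z, e x z & F n z w].
    apply/seteqP; split=> [w [[|z s] [//= /andP[exz ps] ls [sn] h]]|w [wx [z exz [s [ps ls sn h]]]]].
      split; first by apply: h; rewrite mem_head.
      by exists z => //; exists s; split=> // u us; apply: h; rewrite inE us orbT.
    exists (z :: s); split; rewrite /= ?exz ?sn // => u; rewrite inE => /orP[/eqP ->//|].
    exact: h.
  by apply: measurableI; [exact: measurable_open|exact: measurable_exists_vertex].
have -> : [set w : config V | linked e (opens w) x y] = \bigcup_n F n x.
  apply/seteqP; split=> [w [s [ps ls h]]|w [n _ [s [ps ls _ h]]]].
    by exists (size s) => //; exists s.
  by exists s.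
exact: bigcupT_measurable.
Qed.

Lemma measurable_cluster_sub x A :
  measurable [set w : config V | open_cluster e w x `<=` A].
Proof.
have -> : [set w : config V | open_cluster e w x `<=` A] =
    [set w | forall y, ~ A y -> (~` [set w : config V | linked e (opens w) x y]) w].
  apply/seteqP; split=> w h.
    by move=> y nA; rewrite /= -open_clusterE => /h.
  by move=> y Cy; apply: contrapT => /h /=; rewrite -open_clusterE.
apply: (@measurable_forall_vertex _
  (fun y => ~` [set w : config V | linked e (opens w) x y])) => y.
apply: measurableC; exact: measurable_linked.
Qed.

Lemma finite_sub_ball x C : finite_set C -> exists m, C `<=` gball e x m.
Proof.
move=> finC; exists (\max_(z <- enum_fset (fset_set C)) gdist e x z) => y Cy.
by rewrite /gball /=; apply: leq_bigmax_seq => //; rewrite in_fset_set // inE.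
Qed.

Lemma measurable_finite_cluster x :
  measurable [set w : config V | finite_set (open_cluster e w x)].
Proof.
have -> : [set w : config V | finite_set (open_cluster e w x)] =
    \bigcup_m [set w | open_cluster e w x `<=` gball e x m].
  apply/seteqP; split=> w; first by move=> /(finite_sub_ball x)[m h]; exists m.
  by move=> [m _ h]; apply: sub_finite_set h (finite_gball ce lf x m).
by apply: bigcupT_measurable => m; exact: measurable_cluster_sub.
Qed.

(** For a cluster contained in a ball of radius [m], having more than [n] vertices
    means containing one of the finitely many subsets of that ball with more than
    [n] elements. *)
Lemma measurable_large_cluster x n :
  measurable [set w : config V | finite_set (open_cluster e w x) /\
    (n < set_card (open_cluster e w x))%N].
Proof.
have -> : [set w : config V | finite_set (open_cluster e w x) /\
      (n < set_card (open_cluster e w x))%N] =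
    [set w : config V | finite_set (open_cluster e w x)] `&`
    \bigcup_m \bigcup_(A in [set` [fset A in fpowerset (fset_set (gball e x m)) | (n < #|` A|)%N]%fset])
      [set w | forall y, y \in A -> [set w : config V | linked e (opens w) x y] w].
  apply/seteqP; split=> [w [fC nC]|w [fC [m _ [A]]]].
    split=> //; have [m Cm] := finite_sub_ball x fC; exists m => //.
    exists (fset_set (open_cluster e w x)); last first.
      by move=> y; rewrite in_fset_set // inE open_clusterE.
    rewrite /= !inE /= nC andbT fpowersetE; apply/fsubsetP => y.
    rewrite !in_fset_set //; last exact: finite_gball.
    by rewrite !inE => /Cm.
  rewrite /= !inE /= => /andP[_ nA] h; split=> //.
  apply: leq_trans nA _; apply: size_le_set_card => // y /h.
  by rewrite /= open_clusterE.
apply: measurableI; first exact: measurable_finite_cluster.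
apply: bigcupT_measurable => m; apply: fin_bigcup_measurable => // A _.
by apply: measurable_forall_vertex => y; exact: measurable_linked.
Qed.

Lemma measurable_infinite_cluster :
  measurable [set w : config V | exists C, infinite_open_cluster e w C].
Proof.
have -> : [set w : config V | exists C, infinite_open_cluster e w C] =
    [set w | exists2 x, True & (~` [set w : config V | finite_set (open_cluster e w x)]) w].
  apply/seteqP; split=> w; first by move=> [C [iC [x Cx]]]; exists x => //=; rewrite -Cx.
  by move=> [x _ iC]; exists (open_cluster e w x); split=> //; exists x.
apply: (@measurable_exists_vertex _
  (fun x => ~` [set w : config V | finite_set (open_cluster e w x)])) => x.
apply: measurableC; exact: measurable_finite_cluster.
Qed.

End Graph.

Section Prob.
Context {R : realType} (p : R) (P : probability (config V) R).
Hypotheses (p01 : 0 <= p <= 1) (hP : is_product_bernoulli p P).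

Lemma prob_closed (F : {fset V}) :
  P [set w | forall z, z \in F -> ~~ w z] = ((1 - p) ^+ #|` F|)%:E.
Proof.
have := hP F (fun=> false).
have -> : [set w : V -> bool | forall x, x \in F -> w x = false] =
    [set w | forall z, z \in F -> ~~ w z].
  by apply/seteqP; split=> w h z /h; [move=> -> | move/negbTE].
by move=> ->; rewrite big_const_seq count_predT iter_mulr_1.
Qed.

Lemma prob_witnessed (Fs : seq {fset V}) n :
  (forall F, F \in Fs -> #|` F| = n) ->
  (P [set w | witnessed w Fs] <= ((size Fs)%:R * (1 - p) ^+ n)%:E)%E.
Proof.
elim: Fs => [|F Fs ih] hn.
  have -> : [set w : config V | witnessed w [::]] = set0 by apply/seteqP; split=> // w [].
  by rewrite measure0 mul0r.
have -> : [set w : config V | witnessed w (F :: Fs)] =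
    [set w | forall z, z \in F -> ~~ w z] `|` [set w | witnessed w Fs].
  apply/seteqP; split=> w.
    by move=> [G]; rewrite inE => /orP[/eqP -> h|GFs h]; [left|right; exists G].
  by move=> [h|[G GFs h]]; [exists F|exists G]; rewrite // inE ?eqxx ?GFs ?orbT.
apply: le_trans (measureU2 _ (measurable_closed F) (measurable_witnessed Fs)) _.
rewrite /= -addn1 natrD mulrDl mul1r EFinD addeC leeD //.
  by rewrite prob_closed hn // mem_head.
by apply: ih => G GFs; apply: hn; rewrite inE GFs orbT.
Qed.

End Prob.
End Sites.

(** * Decay of the probability of bad boxes *)

(** The exponent of the left-hand side is of the order of g ^ j, while (2 g) ^ j
    exceeds it by the factor 2 ^ j. *)
Lemma scale_growth (l g D m : nat) : (2 <= g)%N -> exists k0, forall j, (k0 <= j)%N ->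
  (l ^ (m.+1 * (D * g ^ j.+1)) * 2 ^ j.+1 <= 2 ^ ((2 * g) ^ j))%N.
Proof.
move=> g2; pose c := (l * (m.+1 * (D * g)))%N.
exists c => j cj.
apply: (@leq_trans (2 ^ (c * g ^ j + j.+1))).
  rewrite expnD leq_mul2r; apply/orP; right.
  have -> : (2 ^ (c * g ^ j) = (2 ^ l) ^ (m.+1 * (D * g ^ j.+1)))%N.
    by rewrite -expnM; congr (2 ^ _)%N; rewrite /c expnS; ring.
  by case: (m.+1 * _)%N => // n; rewrite leq_exp2r // ltnW // ltn_expl.
rewrite leq_exp2l // expnMn.
apply: (@leq_trans (c.+1 * g ^ j)); first by rewrite mulSn addnC leq_add2r; exact: ltn_expl.
by rewrite leq_mul2r (leq_ltn_trans cj (ltn_expl j _)) ?orbT.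
Qed.

Section Tail.
Context {V : choiceType} (e : rel V).
Hypotheses (ce : connected_graph e) (lf : locally_finite e) (cV : countable [set: V]).
Context (l g D : nat).
Hypotheses (l10 : (10 <= l)%N) (g2 : (2 <= g)%N)
  (vol : forall x K, (l <= K)%N -> (set_card (gball e x (10 * K)) <= K ^ D)%N).
Context {R : realType} (p : R) (P : probability (config V) R).
Hypotheses (p01 : 0 <= p <= 1) (hP : is_product_bernoulli p P)
  (hp : (l ^ (D * (2 * g).+1))%:R * (1 - p) <= 2^-1).
Implicit Types x : V.

Lemma prob_shell k x :
  (P [set w | witnessed w (shell e l g k x)] <=
   ((l ^ (D * g ^ k.+1))%:R / 2 ^+ ((2 * g) ^ k))%:E)%E.
Proof.
have q0 : 0 <= 1 - p by case/andP: p01 => ? ?; lra.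
apply: le_trans (prob_witnessed cV hP (@card_shell _ _ l g k x)) _.
rewrite lee_fin; set N := ((2 * g) ^ k)%N.
apply: (@le_trans _ _ ((l ^ (D * g ^ k.+1) * l ^ (D * (2 * g).+1 * N))%:R * (1 - p) ^+ N)).
  by rewrite ler_wpM2r ?exprn_ge0 // ler_nat; exact: size_shell.
rewrite natrM -mulrA ler_wpM2l // expnM natrX -exprMn -exprVn.
by rewrite lerXn2r // ?nnegrE ?invr_ge0 // mulr_ge0.
Qed.

Lemma uncleanE k x : [set w : config V | ~ clean e l g w k x] =
  \bigcup_i [set w : config V | witnessed w (shell e l g (k + i) x)].
Proof.
apply/seteqP; split=> w.
  move=> ncl; apply: contrapT => no; apply: ncl => j kj wj; apply: no.
  by exists (j - k)%N => //=; rewrite subnKC.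
by move=> [i _ wi] cl; apply: (cl (k + i)%N) => //; exact: leq_addr.
Qed.

Lemma measurable_unclean k x : measurable [set w : config V | ~ clean e l g w k x].
Proof. by rewrite uncleanE; apply: bigcupT_measurable => i; exact: measurable_witnessed. Qed.

(** The power [m] of the scale comes for free from [scale_growth]: the failure at
    scale [k + i] has probability at most 2 ^ (- i - 1) times the bound, and these
    are summed over [i]. *)
Lemma prob_unclean m : exists k0, forall k x, (k0 <= k)%N ->
  (P [set w | ~ clean e l g w k x] <= ((l ^ (m * (D * g ^ k.+1)))%:R^-1 / 2 ^+ k)%:E)%E.
Proof.
have [k0 hk0] := scale_growth l D m g2.
exists k0 => k x kk.
set c := (l ^ (m * (D * g ^ k.+1)))%:R^-1 / 2 ^+ k : R.
have c0 : 0 <= c by rewrite divr_ge0 // ?invr_ge0.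
apply: le_trans (epsilon_trick0 xpredT c0).
pose F i := [set w : config V | witnessed w (shell e l g (k + i) x)].
have mF i : measurable (F i) by exact: measurable_witnessed.
have mU := measurable_unclean k x; rewrite uncleanE in mU *.
apply: le_trans (measure_sigma_subadditive P mF mU (@subset_refl _ _)) _.
apply: lee_nneseries => // i _; apply: le_trans (prob_shell _ _) _.
rewrite lee_fin /c; set j := (k + i)%N.
have kj : (k0 <= j)%N by apply: leq_trans kk _; exact: leq_addr.
have l0 : (0 < l)%N by lia.
have -> : (l ^ (m * (D * g ^ k.+1)))%:R^-1 / 2 ^+ k / (2 ^ i.+1)%:R =
    (l ^ (m * (D * g ^ k.+1)) * 2 ^ j.+1)%:R^-1 :> R.
  by rewrite -natrX -mulrA -invfM -natrM -expnD -addnS -invfM -natrM.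
rewrite -natrX ler_pdivrMr ?ltr0n ?expn_gt0 // ler_pdivlMl ?ltr0n ?muln_gt0 ?expn_gt0 ?l0 //.
rewrite -natrM ler_nat; apply: leq_trans (hk0 j kj).
rewrite mulnAC leq_mul2r mulSn expnD mulnC leq_mul2l; apply/orP; right; apply/orP; right.
by rewrite leq_pexp2l // !leq_mul2l leq_pexp2l ?orbT ?ltnS ?leq_addr //; lia.
Qed.

End Tail.

(** * Choice of the constants *)

Lemma ex_nat_ge {R : realType} (x : R) : exists n : nat, x <= n%:R.
Proof.
exists (Num.bound `|x|); apply: le_trans (ler_norm x) _.
by apply/ltW/archi_boundP.
Qed.

(** [D] absorbs the volume exponent, the constant [cu] and the factor 10; then
    [g] is chosen so that [K ^ g] beats [K ^ (2 * D)] after the isoperimetric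
    exponent; finally [l] absorbs the remaining constants. *)
Lemma exists_scales {R : realType} (di ci du cu : R) :
  1 < di -> 0 < ci -> 1 < du -> 0 < cu ->
  exists l g D : nat, [/\ (10 <= l)%N, (2 <= g)%N, (0 < D)%N &
   [/\ forall K, (l <= K)%N -> cu * (10 * K)%:R `^ du <= (K ^ D)%:R,
       forall K, (l <= K)%N -> (2 * (2 * g * K ^ D) <= K ^ g)%N &
       forall K, (l <= K)%N ->
         (2 * g * K ^ D * K ^ D)%:R < ci * ((K ^ g)%:R / 2) `^ ((di - 1) / di)]].
Proof.
move=> hdi hci hdu hcu; set al := (di - 1) / di.
have di0 : 0 < di by exact: lt_trans hdi.
have al0 : 0 < al by rewrite divr_gt0 // subr_gt0.
have al1 : al <= 1 by rewrite /al ler_pdivrMr // mul1r gerBl.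
have [D' hD'] := ex_nat_ge du.
pose D := D'.+1.
have [g1 hg1] := ex_nat_ge ((2 * D).+1%:R / al).
pose g := (2 + D + g1)%N.
have [l1 hl1] := ex_nat_ge (cu * 10 `^ du).
have [l2 hl2] := ex_nat_ge ((4 * g)%:R / ci).
pose l := (10 + l1 + l2 + 4 * g)%N.
exists l, g, D; split; rewrite ?/l ?/g ?/D; try lia.
rewrite -/D -/g -/l; split=> K lK.
- have K1 : (1 <= K)%N by rewrite /l in lK; lia.
  rewrite natrM powRM // mulrA natrX exprS.
  apply: ler_pM; rewrite ?mulr_ge0 ?powR_ge0 ?(ltW hcu) //.
    by apply: le_trans hl1 _; rewrite ler_nat /l in lK *; lia.
  by rewrite -powR_mulrn // ler_powR // ler1n.
- have K1 : (1 <= K)%N by rewrite /l in lK; lia.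
  apply: (@leq_trans (K * K ^ D)).
    by rewrite !mulnA leq_mul2r; apply/orP; right; rewrite /l in lK; lia.
  by rewrite -expnS leq_pexp2l // /g; lia.
- have K1 : (1 <= K)%N by rewrite /l in lK; lia.
  have h2 : (2^-1 : R) <= (2^-1) `^ al.
    by rewrite ger1_powR //; lra.
  rewrite powRM // ?invr_ge0 //.
  have hK : (K ^ (2 * D).+1)%:R <= (K ^ g)%:R `^ al :> R.
    rewrite !natrX -!powR_mulrn // -powRrM ler_powR ?ler1n //.
    rewrite -ler_pdivrMr //; apply: le_trans hg1 _.
    by rewrite ler_nat /g leq_addl.
  have hKl : (4 * g)%:R < ci * K%:R.
    rewrite -ltr_pdivrMl // mulrC; apply: le_lt_trans hl2 _.
    by rewrite ltr_nat /l in lK *; lia.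
  apply: (@lt_le_trans _ _ (ci * ((K ^ (2 * D).+1)%:R / 2))); last first.
    by rewrite ler_wpM2l ?(ltW hci) // ler_pM.
  have -> : (2 * g * K ^ D * K ^ D)%:R = (4 * g)%:R * (K ^ (2 * D))%:R / 2 :> R.
    by rewrite [(2 * D)%N]mul2n -addnn expnD !natrM; field.
  rewrite expnS [(K * _)%:R]natrM !mulrA ltr_pM2r ?invr_gt0 //.
by rewrite ltr_pM2r // ltr0n expn_gt0 K1.
Qed.

(** * Infinite clusters, large finite clusters and the critical point *)

Lemma half_pow_small {R : realType} (eps : R) : 0 < eps ->
  exists n, forall k, (n <= k)%N -> (2 ^+ k)^-1 <= eps.
Proof.
move=> eps0; have [n hn] := ex_nat_ge eps^-1.
exists n => k nk; rewrite invf_ple ?posrE ?exprn_gt0 //.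
apply: le_trans hn _; rewrite -natrX ler_nat.
by apply: leq_trans nk _; apply/ltnW; exact: ltn_expl.
Qed.

Section Conclusions.
Context {V : choiceType} (e : rel V).
Hypotheses (se : simple_graph e) (ce : connected_graph e)
  (infV : infinite_set [set: V]) (lf : locally_finite e).
Context {R : realType} (di ci : R).
Hypotheses (hdi : 1 < di) (hci : 0 < ci) (iso : local_isoperimetry di ci e).
Context (l g D : nat).
Hypotheses (l10 : (10 <= l)%N) (g2 : (2 <= g)%N) (D0 : (0 < D)%N)
  (vol : forall x K, (l <= K)%N -> (set_card (gball e x (10 * K)) <= K ^ D)%N)
  (numN : forall K, (l <= K)%N -> (2 * (2 * g * K ^ D) <= K ^ g)%N)
  (numR : forall K, (l <= K)%N ->
    (2 * g * K ^ D * K ^ D)%:R < ci * ((K ^ g)%:R / 2) `^ ((di - 1) / di)).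
Context (p : R) (P : probability (config V) R).
Hypotheses (p01 : 0 <= p <= 1) (hP : is_product_bernoulli p P)
  (hp : (l ^ (D * (2 * g).+1))%:R * (1 - p) <= 2^-1).

Let cV : countable [set: V]. Proof. exact: countable_vertices. Qed.

Lemma ae_unique_infinite_cluster :
  {ae P, forall w, exists! C, infinite_open_cluster e w C}.
Proof.
have [x _] := infinite_setN0 infV.
have [k0 hk0] := prob_unclean ce lf cV l10 g2 vol p01 hP hp 0.
pose N := \bigcap_k [set w : config V | ~ clean e l g w k x].
have mU k : measurable [set w : config V | ~ clean e l g w k x].
  exact: measurable_unclean.
exists N; split.
- exact: bigcap_measurableType.
- apply/eqP; rewrite eq_le measure_ge0 andbT; apply/lee_addgt0Pr => eps eps0.
  have [n hn] := half_pow_small eps0; rewrite add0e.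
  apply: (@le_trans _ _ (P [set w : config V | ~ clean e l g w (k0 + n)%N x])).
    apply: le_measure; rewrite ?inE //; first exact: bigcap_measurableType.
    by move=> w; apply.
  apply: le_trans (hk0 _ x (leq_addr _ _)) _.
  by rewrite lee_fin mul0n expn0 invr1 mul1r; apply: hn; exact: leq_addl.
- move=> w nuniq k _ cl; apply: nuniq.
  exact: (clean_unique_infinite se ce infV lf hdi hci iso l10 g2 vol numN numR cl).
Qed.

Let large x n := [set w : config V | finite_set (open_cluster e w x) /\
   (n < set_card (open_cluster e w x))%N].

(** A cluster with more than [l ^ (D * g ^ k)] vertices leaves the ball of radius
    [scale k], which has at most that many; around a clean [x] it is then
    infinite.  The upper bound on [n] turns the decay in the scale into decay in [n]. *)
Lemma prob_large_finite_cluster m : exists k0, forall k n, (k0 <= k)%N ->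
  (l ^ (D * g ^ k) <= n < l ^ (D * g ^ k.+1))%N ->
  forall x, (P (large x n) <= ((n ^ m)%:R^-1 / 2 ^+ k)%:E)%E.
Proof.
have [k0 hk0] := prob_unclean ce lf cV l10 g2 vol p01 hP hp m.
exists k0 => k n kk /andP[n1 n2] x.
have l0 : (0 < l)%N by lia.
have n0 : (0 < n)%N by apply: leq_trans n1; rewrite expn_gt0 l0.
apply: (@le_trans _ _ (P [set w : config V | ~ clean e l g w k x])).
  apply: le_measure; rewrite ?inE.
  - exact: measurable_large_cluster.
  - exact: measurable_unclean.
  - move=> w lw cl; move: lw.
    apply: (clean_no_large_finite se ce infV lf hdi hci iso l10 g2 vol numN numR cl).
    apply: leq_trans n1; apply: (size_ball_seq ce lf l10 g2 vol); lia.
apply: le_trans (hk0 k x kk) _; rewrite lee_fin ler_wpM2r ?invr_ge0 ?exprn_ge0 //.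
rewrite lef_pV2 ?posrE ?ltr0n ?expn_gt0 ?l0 ?n0 // ler_nat mulnC expnM.
by case: (m) => // m'; rewrite leq_exp2r // ltnW.
Qed.

Lemma cvg_large_finite_cluster (chi : R) :
  ((n%:R `^ chi)%:E * ereal_sup [set P (large x n) | x in [set: V]])%E
    @[n --> \oo] --> (0 : \bar R).
Proof.
have [x0 _] := infinite_setN0 infV.
have [m hm] := ex_nat_ge chi.
have [k0 hk0] := prob_large_finite_cluster m.
set S := fun n => ereal_sup [set P (large x n) | x in [set: V]].
have S0 n : (0 <= S n)%E.
  apply: le_trans (measure_ge0 P (large x0 n)) _.
  by apply: ereal_sup_ubound; exists x0.
have S1 n : (S n <= 1)%E.
  apply: ge_ereal_sup => _ [x _ <-]; apply: probability_le1; exact: measurable_large_cluster.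
have Sfin n : S n \is a fin_num.
  by rewrite ge0_fin_numE //; apply: le_lt_trans (S1 n) (ltry _).
apply: cvg_EFin.
  by near=> n; apply: fin_numM => //; exact: Sfin.
apply/cvgrPdist_le => eps eps0.
have [K hK] := half_pow_small eps0.
pose k1 := (k0 + K)%N.
near=> n.
have nn : (l ^ (D * g ^ k1) <= n)%N by near: n; exact: nbhs_infty_ge.
(* The scale adapted to n is the last one with l ^ (D * g ^ k) <= n. *)
have [k [kk kn]] : exists k, (k1 <= k)%N /\ (l ^ (D * g ^ k) <= n < l ^ (D * g ^ k.+1))%N.
  have ub i : (l ^ (D * g ^ i) <= n)%N -> (i <= n)%N.
    move=> h; apply: leq_trans h; apply: leq_trans (leq_scale l10 g2 i) _.
    by rewrite leq_pexp2l ?leq_pmull //; lia.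
  have [i hi imax] := ex_maxnP (ex_intro _ k1 nn) ub.
  exists i; split; first exact: imax.
  by rewrite hi ltnNge; apply/negP => /imax; rewrite ltnn.
have n1 : (1 <= n)%N by apply: leq_trans nn; rewrite expn_gt0; lia.
have Sn : (S n <= ((n ^ m)%:R^-1 / 2 ^+ k)%:E)%E.
  apply: ge_ereal_sup => _ [x _ <-]; apply: hk0 kn x; rewrite /k1 in kk; lia.
rewrite sub0r normrN /= -/(S n) fineM // ger0_norm ?mulr_ge0 ?powR_ge0 ?fine_ge0 //=.
have Sn' : fine (S n) <= (n ^ m)%:R^-1 / 2 ^+ k by rewrite -lee_fin fineK.
apply: (@le_trans _ _ (2 ^+ k)^-1); last by apply: hK; rewrite /k1 in kk; lia.
apply: (@le_trans _ _ ((n ^ m)%:R * ((n ^ m)%:R^-1 / 2 ^+ k))).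
  apply: ler_pM; rewrite ?powR_ge0 ?fine_ge0 //.
  by rewrite natrX -powR_mulrn // ler_powR // ler1n.
by rewrite mulrA divff ?mul1r // pnatr_eq0 -lt0n expn_gt0 n1.
Unshelve. all: by end_near. Qed.

End Conclusions.

Lemma critical_probability_le {R : realType} {V : choiceType} (e : rel V) (pstar : R) :
  simple_graph e -> infinite_set [set: V] -> connected_graph e -> locally_finite e ->
  0 <= pstar ->
  (forall p : R, pstar < p <= 1 -> {ae (bernoulli_site p : probability (config V) R),
     forall w, exists! C, infinite_open_cluster e w C}) ->
  critical_probability e <= pstar.
Proof.
move=> se infV ce lf p0 hae; have cV := countable_vertices ce infV lf.
rewrite /critical_probability; set X := (X in sup X).
have [->|/set0P X0] := eqVneq X set0; first by rewrite sup0.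
apply: ge_sup => // p [/andP[p00 p1] hP0]; rewrite leNgt; apply/negP => pp.
have := hae p; rewrite pp p1 => /(_ isT) [N [mN N0 sub]].
set P := (bernoulli_site p : probability (config V) R) in hP0 N0.
have mI := measurable_infinite_cluster cV ce lf.
have : (P setT <= P ([set w : config V | exists C, infinite_open_cluster e w C] `|` N))%E.
  apply: le_measure; rewrite ?inE //; first exact: measurableU.
  move=> w _; have [u|nu] := pselect (exists! C, infinite_open_cluster e w C).
    by left; have [C [iC _]] := u; exists C.
  by right; apply: sub.
rewrite probability_setT => /le_trans/(_ (measureU2 _ mI mN)).
by rewrite [X in (X + _)%E]hP0 [X in (_ + X)%E]N0 adde0 lee_fin ler10.
Qed.

Theorem theorem1p4 (R : realType) (di ci du cu : R) (hdi : 1 < di) (hdu : 1 < du)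
    (hci : 0 < ci) (hcu : 0 < cu) :
  (forall (V : choiceType) (e : rel V),
      simple_graph e -> infinite_set [set: V] -> connected_graph e ->
      locally_finite e -> local_isoperimetry di ci e -> volume_upper du cu e ->
      critical_probability e < 1 :> R)
  /\
  (forall dl cl : R,
    exists pstar : R, 0 <= pstar < 1 /\
    forall (V : choiceType) (e : rel V),
      simple_graph e -> infinite_set [set: V] -> connected_graph e ->
      locally_finite e -> local_isoperimetry di ci e -> volume_upper du cu e ->
      volume_lower dl cl e ->
      (forall p : R, pstar < p <= 1 ->
         {ae (bernoulli_site p : probability (config V) R),
           forall w, exists! C, infinite_open_cluster e w C})
      /\
      (forall chi : R, 0 < chi ->
         exists pchi : R, 0 <= pchi < 1 /\
         forall p : R, pchi < p <= 1 ->
           ((n%:R `^ chi)%:E *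
             ereal_sup [set bernoulli_site p
                 [set w | finite_set (open_cluster e w x) /\
                          (n < set_card (open_cluster e w x))%N] | x in [set: V]])%E
             @[n --> \oo] --> (0 : \bar R))).
Proof.
have [l [g [D [l10 g2 D0 [hvol numN numR]]]]] := exists_scales hdi hci hdu hcu.
pose M : R := (l ^ (D * (2 * g).+1))%:R.
have M1 : 1 <= M by rewrite ler1n expn_gt0; lia.
pose pstar := 1 - (2 * M)^-1.
have pstar01 : 0 <= pstar < 1.
  rewrite subr_ge0 invf_le1 ?mulr_gt0 //; last by lra.
  by rewrite gtrBl invr_gt0 mulr_gt0 ?andbT; lra.
have hp p : pstar < p <= 1 -> 0 <= p <= 1 /\ M * (1 - p) <= 2^-1.
  move=> /andP[pp p1]; case/andP: pstar01 => ps0 ps1; split.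
    by rewrite p1 andbT; lra.
  have : 1 - p <= (2 * M)^-1 by rewrite /pstar in pp; lra.
  move=> h; rewrite -ler_pdivlMl; last by lra.
  by rewrite -invfM mulrC.
have vol (V : choiceType) (e : rel V) : volume_upper du cu e ->
    forall x K, (l <= K)%N -> (set_card (gball e x (10 * K)) <= K ^ D)%N.
  move=> vu x K lK; rewrite -(ler_nat R); apply: le_trans (hvol K lK).
  by apply: vu; lia.
have ae_uniq (V : choiceType) (e : rel V) :
    simple_graph e -> infinite_set [set: V] -> connected_graph e ->
    locally_finite e -> local_isoperimetry di ci e -> volume_upper du cu e ->
    forall p : R, pstar < p <= 1 ->
    {ae (bernoulli_site p : probability (config V) R),
       forall w, exists! C, infinite_open_cluster e w C}.
  move=> se infV ce lf iso vu p /hp[p01 Mp].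
  have hP := bernoulli_siteP (countable_vertices ce infV lf) p01.
  exact: (ae_unique_infinite_cluster se ce infV lf hdi hci iso l10 g2 (vol _ _ vu) numN numR p01 hP Mp).
split.
  move=> V e se infV ce lf iso vu.
  apply: (@le_lt_trans _ _ pstar); last by case/andP: pstar01.
  apply: critical_probability_le => //; first by case/andP: pstar01.
  exact: ae_uniq.
move=> dl cl; exists pstar; split=> // V e se infV ce lf iso vu _; split.
  exact: ae_uniq.
move=> chi _; exists pstar; split=> // p /hp[p01 Mp].
have hP := bernoulli_siteP (countable_vertices ce infV lf) p01.
exact: (cvg_large_finite_cluster se ce infV lf hdi hci iso l10 g2 D0 (vol _ _ vu) numN numR p01 hP Mp).
Qed.
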